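(* Let $I=[a,b]$ be a segment with $a<b$. The diffeomorphism group $\mathrm{Diff}(I)$ has a nontrivial one-dimensional central extension given by the group $2$-cocycle $$\chi(\phi,\psi)=\int_a^b\log(\phi_x\circ\psi)\,d\log(\psi_x),\qquad \phi,\psi\in\mathrm{Diff}(I).$$ That is, $\chi(\phi,\psi\circ\eta)+\chi(\psi,\eta)=\chi(\phi\circ\psi,\eta)+\chi(\phi,\psi)$ for all $\phi,\psi,\eta\in\mathrm{Diff}(I)$, and $\chi$ is not a coboundary. The corresponding Lie algebra $\mathrm{Vect}_0(I)$ of vector fields vanishing at the endpoints has a one-dimensional central extension by means of the Lie algebra $2$-cocycle $$\Omega\bigl(u(x)\partial_x,v(x)\partial_x\bigr):=\int_a^b\bigl(u_xv_{xx}-u_{xx}v_x\bigr)\,dx,\qquad u\,\partial_x,v\,\partial_x\in\mathrm{Vect}_0(I);$$ that is, $\Omega$ is a skew-symmetric bilinear form with $\Omega([X,Y],Z)+\Omega([Y,Z],X)+\Omega([Z,X],Y)=0$ for all $X,Y,Z\in\mathrm{Vect}_0(I)$.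
   Context: $\mathrm{Diff}(I)$ is the group of orientation-preserving $C^\infty$ diffeomorphisms of $I=[a,b]$ (smooth up to the boundary), a Fréchet Lie group (an open convex-type subset of an affine subspace of $C^\infty(I)$). $\mathrm{Vect}_0(I)$ is the Lie algebra of $C^\infty$ vector fields $u(x)\partial_x$ on $I$ with $u(a)=u(b)=0$, with bracket $[u\partial_x,v\partial_x]=(uv_x-u_xv)\partial_x$. The central extension of $\mathrm{Diff}(I)$ defined by $\chi$ is $\mathrm{Diff}(I)\times\mathbb R$ with product $(\phi,s)(\psi,t)=(\phi\circ\psi,\,s+t+\chi(\phi,\psi))$. The cocycle $\chi$ is a coboundary if there is a smooth function $f:\mathrm{Diff}(I)\to\mathbb R$ with $\chi(\phi,\psi)=f(\phi)+f(\psi)-f(\phi\circ\psi)$ for all $\phi,\psi$; the extension is nontrivial if $\chi$ is not a coboundary. The central extension of $\mathrm{Vect}_0(I)$ defined by $\Omega$ is $\mathrm{Vect}_0(I)\oplus\mathbb R$ with bracket $[(X,\alpha),(Y,\beta)]=([X,Y],\Omega(X,Y))$. *)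

(* Defs.v *)
From Stdlib Require Import Reals List.
From Coquelicot Require Import Coquelicot.
Local Open Scope R_scope.

(* A function on I = [a,b] is represented by a function R -> R of which only
   the restriction to [a,b] matters.  Every notion below depends on that
   restriction only; equality of functions on I is equality on [a,b]. *)

Definition in_I (a b x : R) : Prop := a <= x <= b.

(* Coquelicot's [is_derive] with [locally x] replaced by its trace on [a,b]:
   the usual derivative inside ]a,b[, the one-sided derivative at a and b. *)
Definition is_derive_I (a b : R) (f : R -> R) (x l : R) : Prop :=
  filterdiff f (within (in_I a b) (locally x)) (fun h : R => scal h l).

Definition ex_derive_I (a b : R) (f : R -> R) (x : R) : Prop :=
  exists l : R, is_derive_I a b f x l.

Definition Derive_I (a b : R) (f : R -> R) (x : R) : R :=
  iota (is_derive_I a b f x).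

Fixpoint Derive_I_n (a b : R) (f : R -> R) (n : nat) : R -> R :=
  match n with
  | O => f
  | S m => Derive_I a b (Derive_I_n a b f m)
  end.

Definition smooth_I (a b : R) (f : R -> R) : Prop :=
  forall (n : nat) (x : R),
    in_I a b x -> ex_derive_I a b (Derive_I_n a b f n) x.

Definition maps_I (a b : R) (f : R -> R) : Prop :=
  forall x : R, in_I a b x -> in_I a b (f x).

Definition Diff (a b : R) (phi : R -> R) : Prop :=
  smooth_I a b phi /\
  maps_I a b phi /\
  (exists psi : R -> R,
     smooth_I a b psi /\
     maps_I a b psi /\
     (forall x : R, in_I a b x -> psi (phi x) = x) /\
     (forall x : R, in_I a b x -> phi (psi x) = x)) /\
  (forall x : R, in_I a b x -> 0 < Derive_I a b phi x).

Definition comp (phi psi : R -> R) : R -> R := fun x => phi (psi x).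

(* Vect_0(I); the vector field u(x) d/dx is represented by its coefficient u. *)
Definition Vect0 (a b : R) (u : R -> R) : Prop :=
  smooth_I a b u /\ u a = 0 /\ u b = 0.

Definition bracket (a b : R) (u v : R -> R) : R -> R :=
  fun x => u x * Derive_I a b v x - Derive_I a b u x * v x.

(* d log(psi_x) is the differential form (log psi_x)_x dx. *)
Definition chi (a b : R) (phi psi : R -> R) : R :=
  RInt (fun x => ln (Derive_I a b phi (psi x)) *
                 Derive_I a b (fun y => ln (Derive_I a b psi y)) x) a b.

Definition Omega (a b : R) (u v : R -> R) : R :=
  RInt (fun x => Derive_I a b u x * Derive_I_n a b v 2 x -
                 Derive_I_n a b u 2 x * Derive_I a b v x) a b.

(* The sets { v | Cinf_close a b m d u v }, for m in N and d > 0, form a basis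
   of neighbourhoods of u in the Frechet space C^oo(I). *)
Definition Cinf_close (a b : R) (m : nat) (d : R) (u v : R -> R) : Prop :=
  forall (j : nat) (x : R), (j <= m)%nat -> in_I a b x ->
    Rabs (Derive_I_n a b v j x - Derive_I_n a b u j x) < d.

(* Smoothness, in the usual sense of calculus on Frechet spaces
   (Michal-Bastiani, Hamilton), of a real function f on Diff(I), an open subset
   of the affine space { phi in C^oo(I) | phi a = a, phi b = b } with direction
   Vect_0(I): all the iterated directional derivatives
     F [h_n; ...; h_1] phi = D^n f (phi) (h_1, ..., h_n)
   exist and are jointly continuous on Diff(I) x Vect_0(I)^n.
   Since Diff(I) is open, phi + t k lies in Diff(I) for small t, so the values
   of f and F outside Diff(I) are irrelevant.  Continuity for hs = [] forces
   f phi to depend on the restriction of phi to I only. *)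
Definition smooth_on_Diff (a b : R) (f : (R -> R) -> R) : Prop :=
  exists F : list (R -> R) -> (R -> R) -> R,
    (forall phi : R -> R, Diff a b phi -> F nil phi = f phi) /\
    (forall (hs : list (R -> R)) (k phi : R -> R),
       List.Forall (Vect0 a b) hs -> Vect0 a b k -> Diff a b phi ->
       is_derive (fun t : R => F hs (fun x => phi x + t * k x)) 0
                 (F (k :: hs) phi)) /\
    (forall (hs : list (R -> R)) (phi : R -> R),
       List.Forall (Vect0 a b) hs -> Diff a b phi ->
       forall eps : R, 0 < eps ->
       exists (m : nat) (d : R), 0 < d /\
         forall (hs' : list (R -> R)) (phi' : R -> R),
           List.Forall (Vect0 a b) hs' -> Diff a b phi' ->
           List.Forall2 (Cinf_close a b m d) hs hs' ->
           Cinf_close a b m d phi phi' ->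
           Rabs (F hs' phi' - F hs phi) < eps).

Definition group_cocycle (a b : R) (c : (R -> R) -> (R -> R) -> R) : Prop :=
  forall phi psi eta : R -> R, Diff a b phi -> Diff a b psi -> Diff a b eta ->
    c phi (comp psi eta) + c psi eta = c (comp phi psi) eta + c phi psi.

Definition group_coboundary (a b : R) (c : (R -> R) -> (R -> R) -> R) : Prop :=
  exists f : (R -> R) -> R,
    smooth_on_Diff a b f /\
    forall phi psi : R -> R, Diff a b phi -> Diff a b psi ->
      c phi psi = f phi + f psi - f (comp phi psi).

Definition bilinear_on_Vect0 (a b : R) (w : (R -> R) -> (R -> R) -> R) : Prop :=
  (forall (s t : R) (u v z : R -> R), Vect0 a b u -> Vect0 a b v -> Vect0 a b z ->
     w (fun x => s * u x + t * v x) z = s * w u z + t * w v z) /\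
  (forall (s t : R) (u v z : R -> R), Vect0 a b u -> Vect0 a b v -> Vect0 a b z ->
     w z (fun x => s * u x + t * v x) = s * w z u + t * w z v).

Definition skew_on_Vect0 (a b : R) (w : (R -> R) -> (R -> R) -> R) : Prop :=
  forall u v : R -> R, Vect0 a b u -> Vect0 a b v -> w u v = - w v u.

Definition lie_cocycle (a b : R) (w : (R -> R) -> (R -> R) -> R) : Prop :=
  bilinear_on_Vect0 a b w /\
  skew_on_Vect0 a b w /\
  forall u v z : R -> R, Vect0 a b u -> Vect0 a b v -> Vect0 a b z ->
    w (bracket a b u v) z + w (bracket a b v z) u + w (bracket a b z u) v = 0.

(* Main.v *)
Require Import Defs.
From Stdlib Require Import Reals Lra Lia List FunctionalExtensionality.
From Coquelicot Require Import Coquelicot.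
Local Open Scope R_scope.

(** Group cocycle.  By the chain rule, [logD phi = log phi_x] satisfies
    [logD (phi o psi) = logD phi o psi + logD psi].  Substituting this in the
    four integrals, everything cancels except
    [int (logD phi o psi o eta) d(logD psi o eta)] against
    [int (logD phi o psi) d(logD psi)], which agree by the change of variables
    [eta] ([chi_group_cocycle]).

    Lie algebra cocycle.  The integrand of the cyclic sum of [Omega [u,v] z] is
    the exact derivative of a function that vanishes wherever [u], [v] and [z]
    do ([Omega_jacobi]).

    Nontriviality.  Suppose that [chi] is the coboundary of a smooth [f].  For
    vector fields [u], [v] and [phi = id + t u], [psi = id + t v], we get
    [f (phi o psi) - f (psi o phi) = chi psi phi - chi phi psi].  The right-hand
    side is [- t^2 Omega u v + O(t^3)] ([chi_expansion]).  On the other hand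
    [phi o psi = psi o phi + t^2 k_t] with [k_t] tending to [v u_x - u v_x], so
    the mean value theorem along the segment from [psi o phi] to [phi o psi] and
    the continuity of the differential of [f] give, in the limit,
    [Df (id) (v u_x - u v_x) = - Omega u v] ([coboundary_derivative]).  Hence
    [Omega u v] depends on the bracket of [u] and [v] only.  This fails already
    for polynomial fields: two explicit pairs have the same bracket and different
    values of [Omega] ([chi_not_coboundary]).

    Restricting to polynomial [u] and [v] makes all the families of maps
    involved polynomial in the parameters, so that their convergence in
    [C^oo(I)] is elementary, and makes the smoothness of their inverses explicit
    ([ev_inverse_smooth]). *)

(** * Calculus on a segment *)

Section Segment.

Context (a b : R) (hab : a < b).

(** The only limit of the trace on the segment of the neighbourhoods of [x] is
    [x] itself; whence the usual description of the derivative. *)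
Lemma is_derive_I_eps (f : R -> R) (x l : R) : in_I a b x ->
  is_derive_I a b f x l <->
  (forall eps, 0 < eps -> exists d, 0 < d /\ forall y, in_I a b y ->
     Rabs (y - x) < d -> Rabs (f y - f x - (y - x) * l) <= eps * Rabs (y - x)).
Proof.
  intros hx.
  assert (hl : is_filter_lim (within (in_I a b) (locally x)) x)
    by (intros P HP; exact (filter_le_within (in_I a b) P HP)).
  split.
  - intros [_ H] eps heps.
    destruct (H x hl (mkposreal eps heps)) as [d Hd].
    exists d; split; [apply cond_pos|].
    intros y hy hyd. exact (Hd y hyd hy).
  - intros H; split.
    + apply @is_linear_scal_l.
    + intros z hz.
      assert (z = x) as ->.
      { assert (FF : ProperFilter' (within (in_I a b) (locally x))).
        { constructor; [| apply within_filter, locally_filter].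
          intros HF. exact (locally_singleton _ _ HF hx). }
        exact (is_filter_lim_unique _ _ hz hl). }
      intros eps. destruct (H eps (cond_pos eps)) as (d & hd & Hd).
      exists (mkposreal d hd). intros y hy hyI. exact (Hd y hyI hy).
Qed.

(** The rules of differentiation come from those of [D_in]. *)
Lemma is_derive_I_D_in (f g : R -> R) (x : R) : in_I a b x ->
  is_derive_I a b f x (g x) <-> D_in f g (in_I a b) x.
Proof.
  intros hx. rewrite is_derive_I_eps by exact hx. split.
  - intros H eps heps. destruct (H (eps / 2)) as (d & hd & Hd); [lra|].
    exists d; split; [exact hd|]. intros y [[hy hne] hyd].
    simpl in *; unfold Rdist in *.
    replace ((f y - f x) / (y - x) - g x)
      with ((f y - f x - (y - x) * g x) / (y - x)) by (field; lra).
    assert (0 < Rabs (y - x)) by (apply Rabs_pos_lt; lra).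
    unfold Rdiv at 1. rewrite Rabs_mult, Rabs_inv.
    apply Rmult_lt_reg_r with (Rabs (y - x)); [assumption|].
    rewrite Rmult_assoc, Rinv_l, Rmult_1_r by lra.
    eapply Rle_lt_trans; [apply Hd; assumption|]. nra.
  - intros H eps heps. destruct (H eps heps) as (d & hd & Hd).
    exists d; split; [exact hd|]. intros y hy hyd.
    destruct (Req_dec y x) as [-> | hne].
    { replace (f x - f x - (x - x) * g x) with 0 by ring.
      replace (x - x) with 0 by ring. rewrite Rabs_R0. lra. }
    assert (hlt := Hd y (conj (conj hy (not_eq_sym hne)) hyd)).
    simpl in hlt; unfold Rdist in hlt.
    replace (f y - f x - (y - x) * g x)
      with (((f y - f x) / (y - x) - g x) * (y - x)) by (field; lra).
    rewrite Rabs_mult. apply Rmult_le_compat_r; [apply Rabs_pos | lra].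
Qed.

Lemma is_derive_I_unique (f : R -> R) (x l1 l2 : R) : in_I a b x ->
  is_derive_I a b f x l1 -> is_derive_I a b f x l2 -> l1 = l2.
Proof.
  intros hx h1 h2.
  apply (is_derive_I_D_in f (fun _ => l1) x hx) in h1.
  apply (is_derive_I_D_in f (fun _ => l2) x hx) in h2.
  refine (single_limit _ _ _ _ _ _ h1 h2).
  intros d hd. unfold in_I, D_x in *.
  set (e := Rmin d (b - a) / 2).
  assert (0 < e /\ e < d /\ e <= (b - a) / 2) as (e0 & e1 & e2).
  { unfold e, Rmin. destruct Rle_dec; lra. }
  destruct (Rle_dec (x + e) b).
  - exists (x + e). split; [split; lra|]. simpl; unfold Rdist.
    rewrite Rabs_pos_eq; lra.
  - exists (x - e). split; [split; lra|]. simpl; unfold Rdist.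
    rewrite Rabs_left; lra.
Qed.

Lemma Derive_I_eq (f : R -> R) (x l : R) : in_I a b x ->
  is_derive_I a b f x l -> Derive_I a b f x = l.
Proof.
  intros hx h. unfold Derive_I.
  refine (iota_unique (V := R_CompleteNormedModule) _ l _ h).
  intros y hy. exact (is_derive_I_unique f x y l hx hy h).
Qed.

Lemma is_derive_I_ext (f g : R -> R) (x l : R) : in_I a b x ->
  (forall y, in_I a b y -> f y = g y) ->
  is_derive_I a b f x l -> is_derive_I a b g x l.
Proof.
  intros hx e. rewrite !is_derive_I_eps by exact hx.
  intros H eps heps. destruct (H eps heps) as (d & hd & Hd).
  exists d; split; [exact hd|]. intros y hy hyd.
  rewrite <- !e by assumption. exact (Hd y hy hyd).
Qed.

Lemma is_derive_is_derive_I (f : R -> R) (x l : R) : in_I a b x ->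
  is_derive f x l -> is_derive_I a b f x l.
Proof.
  intros hx [_ H]. apply is_derive_I_eps; [exact hx|]. intros eps heps.
  destruct (H x (fun P HP => HP) (mkposreal eps heps)) as [d Hd].
  exists d; split; [apply cond_pos|]. intros y _ hyd. exact (Hd y hyd).
Qed.

(** [deriv_I f g]: on the segment, [f] has derivative [g]. *)
Definition deriv_I (f g : R -> R) : Prop :=
  forall x, in_I a b x -> is_derive_I a b f x (g x).

Lemma deriv_I_Derive (f g : R -> R) : deriv_I f g ->
  forall x, in_I a b x -> Derive_I a b f x = g x.
Proof. intros h x hx. apply Derive_I_eq; auto. Qed.

Lemma deriv_I_ext (f f' g g' : R -> R) :
  (forall x, in_I a b x -> f x = f' x) -> (forall x, in_I a b x -> g x = g' x) ->
  deriv_I f g -> deriv_I f' g'.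
Proof.
  intros ef eg h x hx. rewrite <- eg by exact hx.
  apply is_derive_I_ext with f; auto.
Qed.

Lemma deriv_I_of_derive (f g : R -> R) :
  (forall x, in_I a b x -> is_derive f x (g x)) -> deriv_I f g.
Proof. intros h x hx. apply is_derive_is_derive_I; auto. Qed.

Lemma deriv_I_plus (f f' g g' : R -> R) : deriv_I f f' -> deriv_I g g' ->
  deriv_I (fun x => f x + g x) (fun x => f' x + g' x).
Proof.
  intros hf hg x hx. apply is_derive_I_D_in with (g := fun x => f' x + g' x); [exact hx|].
  apply Dadd; apply is_derive_I_D_in; auto.
Qed.

Lemma deriv_I_minus (f f' g g' : R -> R) : deriv_I f f' -> deriv_I g g' ->
  deriv_I (fun x => f x - g x) (fun x => f' x - g' x).
Proof.
  intros hf hg x hx. apply is_derive_I_D_in with (g := fun x => f' x - g' x); [exact hx|].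
  apply Dminus; apply is_derive_I_D_in; auto.
Qed.

Lemma deriv_I_mult (f f' g g' : R -> R) : deriv_I f f' -> deriv_I g g' ->
  deriv_I (fun x => f x * g x) (fun x => f' x * g x + f x * g' x).
Proof.
  intros hf hg x hx.
  apply is_derive_I_D_in with (g := fun x => f' x * g x + f x * g' x); [exact hx|].
  apply Dmult; apply is_derive_I_D_in; auto.
Qed.

Lemma deriv_I_scal (c : R) (f f' : R -> R) : deriv_I f f' ->
  deriv_I (fun x => c * f x) (fun x => c * f' x).
Proof.
  intros hf x hx. apply is_derive_I_D_in with (g := fun x => c * f' x); [exact hx|].
  apply Dmult_const; apply is_derive_I_D_in; auto.
Qed.

Lemma is_derive_I_comp (D : R -> Prop) (f f' g g' : R -> R) (x : R) :
  in_I a b x -> (forall y, in_I a b y -> D (f y)) ->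
  is_derive_I a b f x (f' x) -> D_in g g' D (f x) ->
  is_derive_I a b (fun x => g (f x)) x (f' x * g' (f x)).
Proof.
  intros hx hD hf hg.
  apply is_derive_I_D_in with (g := fun x => f' x * g' (f x)); [exact hx|].
  apply is_derive_I_D_in in hf; [|exact hx].
  intros eps heps. destruct (Dcomp _ _ _ _ _ _ _ hf hg eps heps) as (d & hd & Hd).
  exists d; split; [exact hd|]. intros y [[hy hne] hyd].
  apply Hd. unfold D_x, Dgf; auto.
Qed.

Lemma deriv_I_comp (f f' g g' : R -> R) : maps_I a b f ->
  deriv_I f f' -> deriv_I g g' ->
  deriv_I (fun x => g (f x)) (fun x => f' x * g' (f x)).
Proof.
  intros hm hf hg x hx. apply is_derive_I_comp with (in_I a b); auto.
  apply is_derive_I_D_in; auto.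
Qed.

Lemma deriv_I_comp_R (f f' g g' : R -> R) :
  deriv_I f f' -> (forall x, in_I a b x -> is_derive g (f x) (g' (f x))) ->
  deriv_I (fun x => g (f x)) (fun x => f' x * g' (f x)).
Proof.
  intros hf hg x hx. apply is_derive_I_comp with (fun _ => True); auto.
  specialize (hg x hx). apply is_derive_Reals in hg.
  intros eps heps. destruct (hg eps heps) as [d Hd].
  exists d; split; [apply cond_pos|]. intros y [[_ hne] hyd].
  simpl in *; unfold Rdist in *.
  replace (g y) with (g (f x + (y - f x))) by (f_equal; ring).
  apply Hd; auto. lra.
Qed.

Lemma smooth_I_deriv (f : R -> R) (n : nat) : smooth_I a b f ->
  deriv_I (Derive_I_n a b f n) (Derive_I_n a b f (S n)).
Proof.
  intros h x hx. destruct (h n x hx) as [l hl]. simpl.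
  rewrite (Derive_I_eq _ _ _ hx hl). exact hl.
Qed.

(** A family of functions closed under differentiation on the segment consists
    of smooth functions. *)
Lemma smooth_I_family (P : (R -> R) -> Prop) :
  (forall f, P f -> exists g, P g /\ deriv_I f g) ->
  forall f, P f -> smooth_I a b f.
Proof.
  intros hP f hf.
  assert (H : forall n, exists g, P g /\
            forall x, in_I a b x -> g x = Derive_I_n a b f n x).
  { induction n as [|n (g & hg & e)]; [exists f; auto|].
    destruct (hP g hg) as (g' & hg' & hd). exists g'; split; [exact hg'|].
    intros x hx. symmetry. simpl.
    apply deriv_I_Derive; [|exact hx].
    apply deriv_I_ext with g g'; auto. }
  intros n x hx. destruct (H n) as (g & hg & e).
  destruct (hP g hg) as (g' & _ & hd). exists (g' x).
  apply is_derive_I_ext with g; auto.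
Qed.

(** * Integration on a segment *)

(** The retraction of the line onto the segment. *)
Definition clamp (x : R) : R := Rmax a (Rmin x b).

Lemma clamp_in (x : R) : in_I a b (clamp x).
Proof.
  unfold in_I, clamp. split; [apply Rmax_l|].
  apply Rmax_lub; [lra | apply Rmin_r].
Qed.

Lemma clamp_id (x : R) : in_I a b x -> clamp x = x.
Proof.
  intros [h1 h2]. unfold clamp. rewrite Rmin_left by exact h2.
  apply Rmax_right; exact h1.
Qed.

Lemma clamp_lipschitz (x y : R) : Rabs (clamp y - clamp x) <= Rabs (y - x).
Proof.
  unfold clamp, Rmax, Rmin.
  repeat destruct Rle_dec; unfold Rabs; repeat destruct Rcase_abs; lra.
Qed.

(** Continuity on the segment, expressed as continuity on the line of the
    extension that is constant on either side. *)
Definition cont_I (f : R -> R) : Prop :=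
  forall x, continuous (fun y => f (clamp y)) x.

Lemma cont_I_ext (f g : R -> R) :
  (forall x, in_I a b x -> f x = g x) -> cont_I f -> cont_I g.
Proof.
  intros e h x. apply continuous_ext with (fun y => f (clamp y)); [|apply h].
  intros y. apply e, clamp_in.
Qed.

Lemma deriv_I_cont (f g : R -> R) : deriv_I f g -> cont_I f.
Proof.
  intros h x. apply continuity_pt_filterlim. intros eps heps.
  destruct (proj1 (is_derive_I_eps f _ _ (clamp_in x)) (h _ (clamp_in x)) 1)
    as (d & hd & Hd); [lra|].
  set (M := 1 + Rabs (g (clamp x))).
  assert (hM : 0 < M) by (unfold M; generalize (Rabs_pos (g (clamp x))); lra).
  exists (Rmin d (eps / M)). split.
  { apply Rmin_pos; [exact hd | apply Rdiv_lt_0_compat; lra]. }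
  intros y [_ hy]. simpl in *; unfold Rdist in *.
  assert (h1 := Rmin_l d (eps / M)). assert (h2 := Rmin_r d (eps / M)).
  assert (h3 := clamp_lipschitz x y).
  specialize (Hd (clamp y) (clamp_in y) ltac:(lra)).
  replace (f (clamp y) - f (clamp x)) with
    ((f (clamp y) - f (clamp x) - (clamp y - clamp x) * g (clamp x))
     + (clamp y - clamp x) * g (clamp x)) by ring.
  eapply Rle_lt_trans; [apply Rabs_triang|]. rewrite Rabs_mult.
  apply Rle_lt_trans with (Rabs (y - x) * M).
  { unfold M. assert (h4 := Rabs_pos (g (clamp x))). nra. }
  assert (Rabs (y - x) < eps / M) by lra.
  replace eps with (eps / M * M) by (field; lra).
  apply Rmult_lt_compat_r; lra.
Qed.

Lemma cont_I_plus (f g : R -> R) : cont_I f -> cont_I g -> cont_I (fun x => f x + g x).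
Proof.
  intros hf hg x.
  apply (continuous_plus (fun y => f (clamp y)) (fun y => g (clamp y))); auto.
Qed.

Lemma cont_I_minus (f g : R -> R) : cont_I f -> cont_I g -> cont_I (fun x => f x - g x).
Proof.
  intros hf hg x.
  apply (continuous_minus (fun y => f (clamp y)) (fun y => g (clamp y))); auto.
Qed.

Lemma cont_I_mult (f g : R -> R) : cont_I f -> cont_I g -> cont_I (fun x => f x * g x).
Proof.
  intros hf hg x.
  apply (continuous_mult (fun y => f (clamp y)) (fun y => g (clamp y))); auto.
Qed.

Lemma cont_I_comp (f g : R -> R) : maps_I a b f -> cont_I f -> cont_I g ->
  cont_I (fun x => g (f x)).
Proof.
  intros hm hf hg x.
  apply continuous_ext with (fun y => g (clamp (f (clamp y)))).
  { intros y. f_equal. apply clamp_id, hm, clamp_in. }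
  apply (continuous_comp (fun y => f (clamp y)) (fun y => g (clamp y))); auto.
Qed.

Lemma cont_I_comp_R (f g : R -> R) : cont_I f ->
  (forall x, in_I a b x -> continuous g (f x)) -> cont_I (fun x => g (f x)).
Proof.
  intros hf hg x.
  apply (continuous_comp (fun y => f (clamp y)) g); auto.
  apply hg, clamp_in.
Qed.

Lemma RInt_ext_I (f g : R -> R) :
  (forall x, in_I a b x -> f x = g x) -> RInt f a b = RInt g a b.
Proof.
  intros e. apply RInt_ext. rewrite Rmin_left, Rmax_right by lra.
  intros x hx. apply e. unfold in_I; lra.
Qed.

Lemma cont_I_ex_RInt (f : R -> R) : cont_I f -> ex_RInt f a b.
Proof.
  intros h. apply ex_RInt_ext with (fun y => f (clamp y)).
  - rewrite Rmin_left, Rmax_right by lra.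
    intros x hx. rewrite clamp_id; [reflexivity | unfold in_I; lra].
  - apply (ex_RInt_continuous (V := R_CompleteNormedModule)). intros; apply h.
Qed.

(** The extension of a differentiable function that is affine on either side of
    the segment; it turns one-sided derivatives into two-sided ones. *)
Definition affine_ext (f g : R -> R) (x : R) : R :=
  f (clamp x) + (x - clamp x) * g (clamp x).

Lemma affine_ext_id (f g : R -> R) (x : R) : in_I a b x -> affine_ext f g x = f x.
Proof. intros hx. unfold affine_ext. rewrite clamp_id by exact hx. ring. Qed.

Lemma affine_ext_derive (f g : R -> R) (x : R) : deriv_I f g -> in_I a b x ->
  is_derive (affine_ext f g) x (g x).
Proof.
  intros h hx. split; [apply @is_linear_scal_l|].
  intros z hz. rewrite <- (is_filter_lim_locally_unique _ _ hz). clear z hz.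
  intros eps.
  destruct (proj1 (is_derive_I_eps f x _ hx) (h x hx) eps (cond_pos eps))
    as (d & hd & Hd).
  (* A radius below which only an endpoint equal to [x] can be crossed. *)
  set (r := Rmin (if Rlt_dec a x then x - a else d) (if Rlt_dec x b then b - x else d)).
  assert (hr : 0 < Rmin d r).
  { unfold r. destruct (Rlt_dec a x), (Rlt_dec x b); repeat apply Rmin_pos; lra. }
  exists (mkposreal _ hr). intros y hy.
  change (Rabs (y - x) < Rmin d r) in hy.
  change (Rabs (affine_ext f g y - affine_ext f g x - (y - x) * g x) <= eps * Rabs (y - x)).
  rewrite (affine_ext_id f g x hx).
  assert (h1 := Rmin_l d r). assert (h2 := Rmin_r d r).
  assert (h3 := Rmin_l (if Rlt_dec a x then x - a else d) (if Rlt_dec x b then b - x else d)).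
  assert (h4 := Rmin_r (if Rlt_dec a x then x - a else d) (if Rlt_dec x b then b - x else d)).
  fold r in h3, h4. assert (heps := cond_pos eps).
  assert (h0 : 0 <= eps * Rabs (y - x)) by (apply Rmult_le_pos; [lra | apply Rabs_pos]).
  unfold in_I in hx.
  destruct (Rlt_dec y a) as [hya | hya].
  { assert (x = a) as ->.
    { destruct (Rlt_dec a x); [|lra]. rewrite Rabs_left in hy; lra. }
    unfold affine_ext. replace (clamp y) with a.
    2: { unfold clamp. rewrite Rmin_left, Rmax_left; lra. }
    replace (_ - _ - _) with 0 by ring. rewrite Rabs_R0. exact h0. }
  destruct (Rlt_dec b y) as [hyb | hyb].
  { assert (x = b) as ->.
    { destruct (Rlt_dec x b); [|lra]. rewrite Rabs_pos_eq in hy; lra. }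
    unfold affine_ext. replace (clamp y) with b.
    2: { unfold clamp. rewrite Rmin_right, Rmax_right; lra. }
    replace (_ - _ - _) with 0 by ring. rewrite Rabs_R0. exact h0. }
  rewrite affine_ext_id by (unfold in_I; lra).
  apply Hd; [unfold in_I; lra | lra].
Qed.

Lemma RInt_deriv_I (f g : R -> R) : deriv_I f g -> cont_I g ->
  RInt g a b = f b - f a.
Proof.
  intros h hc.
  rewrite (RInt_ext_I g (fun y => g (clamp y))) by (intros x hx; rewrite clamp_id; auto).
  apply is_RInt_unique.
  replace (f b - f a) with (minus (affine_ext f g b) (affine_ext f g a)).
  2: { rewrite !affine_ext_id by (unfold in_I; lra). reflexivity. }
  apply (is_RInt_derive (V := R_CompleteNormedModule)); rewrite Rmin_left, Rmax_right by lra.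
  - intros x hx. rewrite clamp_id by exact hx. apply affine_ext_derive; assumption.
  - intros x _. apply hc.
Qed.

Lemma RInt_comp_I (f f' g : R -> R) : maps_I a b f -> f a = a -> f b = b ->
  deriv_I f f' -> cont_I f' -> cont_I g ->
  RInt (fun x => g (f x) * f' x) a b = RInt g a b.
Proof.
  intros hm ha hb hf hf' hg.
  set (F := affine_ext f f').
  assert (h := RInt_comp (fun y => g (clamp y)) F (fun y => f' (clamp y)) a b).
  rewrite Rmin_left, Rmax_right in h by lra.
  assert (ia : in_I a b a) by (unfold in_I; lra).
  assert (ib : in_I a b b) by (unfold in_I; lra).
  unfold F in h. rewrite (affine_ext_id f f' a ia), (affine_ext_id f f' b ib), ha, hb in h.
  rewrite (RInt_ext_I g (fun y => g (clamp y))) by (intros x hx; rewrite clamp_id; auto).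
  rewrite <- h.
  - apply RInt_ext_I. intros x hx. unfold scal; simpl; unfold mult; simpl.
    rewrite affine_ext_id by exact hx. rewrite (clamp_id x hx), clamp_id by (apply hm, hx).
    ring.
  - intros x _. apply hg.
  - intros x hx. split; [|apply hf'].
    rewrite clamp_id by exact hx. apply affine_ext_derive; assumption.
Qed.

Lemma deriv_I_mean_value (f g : R -> R) (x y : R) : deriv_I f g ->
  in_I a b x -> in_I a b y -> x < y ->
  exists z, in_I a b z /\ f y - f x = g z * (y - x).
Proof.
  intros h hx hy hxy. unfold in_I in *.
  destruct (MVT_gen (affine_ext f g) x y g) as (z & hz & e).
  - rewrite Rmin_left, Rmax_right by lra. intros z hz.
    apply affine_ext_derive; [exact h | unfold in_I; lra].
  - rewrite Rmin_left, Rmax_right by lra. intros z hz.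
    apply continuity_pt_filterlim, @ex_derive_continuous.
    exists (g z). apply affine_ext_derive; [exact h | unfold in_I; lra].
  - rewrite Rmin_left, Rmax_right in hz by lra.
    rewrite !affine_ext_id in e by (unfold in_I; lra).
    exists z; split; [lra | exact e].
Qed.

(** * The group cocycle *)

Lemma Diff_increasing (phi : R -> R) (x y : R) : Diff a b phi ->
  in_I a b x -> in_I a b y -> x < y -> phi x < phi y.
Proof.
  intros (hs & _ & _ & hp) hx hy hxy.
  destruct (deriv_I_mean_value phi _ x y (smooth_I_deriv phi 0 hs) hx hy hxy)
    as (z & hz & e).
  assert (0 < Derive_I a b phi z * (y - x)).
  { apply Rmult_lt_0_compat; [apply hp, hz | lra]. }
  simpl in e; lra.
Qed.

Lemma Diff_endpoints (phi : R -> R) : Diff a b phi -> phi a = a /\ phi b = b.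
Proof.
  intros h. assert (hinc := fun x y => Diff_increasing phi x y h).
  destruct h as (_ & hm & (psi & _ & hm' & _ & hr) & _).
  assert (ia : in_I a b a) by (unfold in_I; lra).
  assert (ib : in_I a b b) by (unfold in_I; lra).
  assert (hma := hm a ia). assert (hmb := hm b ib).
  assert (ra := hr a ia). assert (rb := hr b ib).
  assert (ma := hm' a ia). assert (mb := hm' b ib).
  unfold in_I in *. split.
  - destruct (Req_dec (psi a) a) as [e | ne]; [congruence|].
    specialize (hinc a (psi a) ia ma ltac:(lra)). lra.
  - destruct (Req_dec (psi b) b) as [e | ne]; [congruence|].
    specialize (hinc (psi b) b mb ib ltac:(lra)). lra.
Qed.

(** The logarithm of the derivative, [x |-> log (phi_x)]. *)
Definition logD (phi : R -> R) (x : R) : R := ln (Derive_I a b phi x).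

Lemma Diff_deriv (phi : R -> R) : Diff a b phi -> deriv_I phi (Derive_I a b phi).
Proof. intros (hs & _). exact (smooth_I_deriv phi 0 hs). Qed.

Lemma Diff_deriv_cont (phi : R -> R) : Diff a b phi -> cont_I (Derive_I a b phi).
Proof. intros (hs & _). exact (deriv_I_cont _ _ (smooth_I_deriv phi 1 hs)). Qed.

Lemma logD_deriv_explicit (phi : R -> R) : Diff a b phi ->
  deriv_I (logD phi) (fun x => Derive_I_n a b phi 2 x * / Derive_I a b phi x).
Proof.
  intros (hs & _ & _ & hp).
  apply (deriv_I_comp_R (Derive_I a b phi) (Derive_I_n a b phi 2) ln Rinv).
  - exact (smooth_I_deriv phi 1 hs).
  - intros x hx. apply is_derive_ln, hp, hx.
Qed.

Lemma logD_deriv (phi : R -> R) : Diff a b phi ->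
  deriv_I (logD phi) (Derive_I a b (logD phi)).
Proof.
  intros h. eapply deriv_I_ext; [intros; reflexivity | | apply logD_deriv_explicit, h].
  intros x hx. symmetry.
  exact (deriv_I_Derive _ _ (logD_deriv_explicit phi h) x hx).
Qed.

Lemma logD_cont (phi : R -> R) : Diff a b phi -> cont_I (logD phi).
Proof. intros h. exact (deriv_I_cont _ _ (logD_deriv phi h)). Qed.

Lemma Derive_logD_cont (phi : R -> R) : Diff a b phi -> cont_I (Derive_I a b (logD phi)).
Proof.
  intros h. eapply cont_I_ext.
  - intros x hx. symmetry.
    exact (deriv_I_Derive _ _ (logD_deriv_explicit phi h) x hx).
  - assert (hc := Diff_deriv_cont phi h). destruct h as (hs & _ & _ & hp).
    apply cont_I_mult; [exact (deriv_I_cont _ _ (smooth_I_deriv phi 2 hs))|].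
    apply (cont_I_comp_R (Derive_I a b phi) Rinv hc).
    intros x hx. apply continuous_Rinv. apply Rgt_not_eq, hp, hx.
Qed.

Lemma logD_comp (phi psi : R -> R) (x : R) : Diff a b phi -> Diff a b psi ->
  in_I a b x -> logD (comp phi psi) x = logD phi (psi x) + logD psi x.
Proof.
  intros hphi hpsi hx. unfold logD, comp.
  assert (hd := Diff_deriv phi hphi). assert (hd' := Diff_deriv psi hpsi).
  destruct hphi as (_ & _ & _ & hp). destruct hpsi as (_ & hm & _ & hp').
  rewrite (deriv_I_Derive _ _ (deriv_I_comp psi _ phi _ hm hd' hd) x hx).
  rewrite ln_mult; [ring | apply hp', hx | apply hp, hm, hx].
Qed.

Lemma Derive_logD_comp (phi psi : R -> R) (x : R) : Diff a b phi -> Diff a b psi ->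
  in_I a b x ->
  Derive_I a b (logD (comp phi psi)) x
  = Derive_I a b (logD phi) (psi x) * Derive_I a b psi x + Derive_I a b (logD psi) x.
Proof.
  intros hphi hpsi hx.
  apply (deriv_I_Derive (logD (comp phi psi))
    (fun x => Derive_I a b (logD phi) (psi x) * Derive_I a b psi x
              + Derive_I a b (logD psi) x)); [|exact hx].
  apply deriv_I_ext with (fun x => logD phi (psi x) + logD psi x)
    (fun x => Derive_I a b psi x * Derive_I a b (logD phi) (psi x)
              + Derive_I a b (logD psi) x).
  - intros y hy. symmetry. apply logD_comp; assumption.
  - intros y _. ring.
  - apply deriv_I_plus; [|apply logD_deriv, hpsi].
    apply deriv_I_comp; [apply hpsi | apply Diff_deriv, hpsi | apply logD_deriv, hphi].
Qed.

Lemma chi_logD (phi psi : R -> R) :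
  chi a b phi psi = RInt (fun x => logD phi (psi x) * Derive_I a b (logD psi) x) a b.
Proof. reflexivity. Qed.

Lemma RInt_plus_I (f g : R -> R) : cont_I f -> cont_I g ->
  RInt (fun x => f x + g x) a b = RInt f a b + RInt g a b.
Proof.
  intros hf hg.
  apply (RInt_plus (V := R_CompleteNormedModule) f g); apply cont_I_ex_RInt; assumption.
Qed.

Lemma RInt_minus_I (f g : R -> R) : cont_I f -> cont_I g ->
  RInt (fun x => f x - g x) a b = RInt f a b - RInt g a b.
Proof.
  intros hf hg.
  apply (RInt_minus (V := R_CompleteNormedModule) f g); apply cont_I_ex_RInt; assumption.
Qed.

(** [chi] is the Bott cocycle: the chain rule [logD (phi o psi) =
    logD phi o psi + logD psi] reduces the identity to the change of variables
    by [eta] in the integral defining [chi phi psi]. *)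
Lemma chi_group_cocycle : group_cocycle a b (chi a b).
Proof.
  intros phi psi eta hphi hpsi heta. rewrite !chi_logD.
  assert (mpsi : maps_I a b psi) by apply hpsi.
  assert (meta : maps_I a b eta) by apply heta.
  assert (ceta : cont_I eta) by exact (deriv_I_cont _ _ (Diff_deriv eta heta)).
  assert (cpsi : cont_I psi) by exact (deriv_I_cont _ _ (Diff_deriv psi hpsi)).
  assert (c1 : cont_I (fun x => logD phi (psi x)))
    by (apply cont_I_comp; [exact mpsi | exact cpsi | apply logD_cont, hphi]).
  assert (c2 : cont_I (fun x => logD phi (psi x) * Derive_I a b (logD psi) x))
    by (apply cont_I_mult; [exact c1 | apply Derive_logD_cont, hpsi]).
  assert (c3 : cont_I (fun x => logD phi (psi (eta x)))).
  { exact (cont_I_comp eta (fun x => logD phi (psi x)) meta ceta c1). }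
  assert (c4 : cont_I (fun x => logD psi (eta x) * Derive_I a b (logD eta) x)).
  { apply cont_I_mult; [|apply Derive_logD_cont, heta].
    apply cont_I_comp; [exact meta | exact ceta | apply logD_cont, hpsi]. }
  destruct (Diff_endpoints eta heta) as [ea eb].
  rewrite <- (RInt_comp_I eta (Derive_I a b eta)
    (fun x => logD phi (psi x) * Derive_I a b (logD psi) x) meta ea eb
    (Diff_deriv eta heta) (Diff_deriv_cont eta heta) c2).
  assert (c5 : cont_I (fun x => logD phi (psi (eta x))
            * Derive_I a b (logD psi) (eta x) * Derive_I a b eta x)).
  { apply cont_I_mult; [|apply Diff_deriv_cont, heta].
    apply (cont_I_comp eta _ meta ceta c2). }
  assert (c6 : cont_I (fun x => logD phi (psi (eta x)) * Derive_I a b (logD eta) x))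
    by (apply cont_I_mult; [exact c3 | apply Derive_logD_cont, heta]).
  rewrite (RInt_ext_I (fun x => logD phi (comp psi eta x) * _)
    (fun x => logD phi (psi (eta x)) * Derive_I a b (logD psi) (eta x) * Derive_I a b eta x
              + logD phi (psi (eta x)) * Derive_I a b (logD eta) x)).
  2: { intros x hx. rewrite Derive_logD_comp by assumption. unfold comp. ring. }
  rewrite (RInt_ext_I (fun x => logD (comp phi psi) (eta x) * _)
    (fun x => logD phi (psi (eta x)) * Derive_I a b (logD eta) x
              + logD psi (eta x) * Derive_I a b (logD eta) x)).
  2: { intros x hx. rewrite logD_comp by auto. ring. }
  rewrite !RInt_plus_I by assumption. ring.
Qed.

(** * The Lie algebra cocycle *)

Lemma smooth_I_cont (u : R -> R) (n : nat) : smooth_I a b u ->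
  cont_I (Derive_I_n a b u n).
Proof. intros h. exact (deriv_I_cont _ _ (smooth_I_deriv u n h)). Qed.

Lemma RInt_scal_I (c : R) (f : R -> R) : cont_I f ->
  RInt (fun x => c * f x) a b = c * RInt f a b.
Proof.
  intros hf.
  apply (RInt_scal (V := R_CompleteNormedModule) f); apply cont_I_ex_RInt; assumption.
Qed.

Lemma Omega_cont (u v : R -> R) : smooth_I a b u -> smooth_I a b v ->
  cont_I (fun x => Derive_I a b u x * Derive_I_n a b v 2 x -
                   Derive_I_n a b u 2 x * Derive_I a b v x).
Proof.
  intros hu hv.
  apply cont_I_minus; apply cont_I_mult;
    try (apply smooth_I_cont; assumption);
    apply (smooth_I_cont _ 1); assumption.
Qed.

Lemma Omega_skew (u v : R -> R) : smooth_I a b u -> smooth_I a b v ->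
  Omega a b u v = - Omega a b v u.
Proof.
  intros hu hv. transitivity (-1 * Omega a b v u); [|ring]. unfold Omega.
  rewrite <- RInt_scal_I by (apply Omega_cont; assumption).
  apply RInt_ext_I. intros x _. ring.
Qed.

Lemma Derive_I_n_linear (s t : R) (u v : R -> R) (n : nat) (x : R) :
  smooth_I a b u -> smooth_I a b v -> in_I a b x ->
  Derive_I_n a b (fun x => s * u x + t * v x) n x
  = s * Derive_I_n a b u n x + t * Derive_I_n a b v n x.
Proof.
  intros hu hv. revert x. induction n as [|n IH]; intros x hx; [reflexivity|].
  apply (deriv_I_Derive _ (fun x => s * Derive_I_n a b u (S n) x
                                    + t * Derive_I_n a b v (S n) x)); [|exact hx].
  eapply deriv_I_ext;
    [intros y hy; symmetry; apply IH, hy | intros; reflexivity |].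
  apply deriv_I_plus; apply deriv_I_scal; apply smooth_I_deriv; assumption.
Qed.

Lemma smooth_I_linear (s t : R) (u v : R -> R) :
  smooth_I a b u -> smooth_I a b v -> smooth_I a b (fun x => s * u x + t * v x).
Proof.
  intros hu hv n x hx. eexists.
  apply is_derive_I_ext with
    (fun x => s * Derive_I_n a b u n x + t * Derive_I_n a b v n x); [exact hx | |].
  - intros y hy. symmetry. apply Derive_I_n_linear; assumption.
  - apply (deriv_I_plus _ _ _ _ (deriv_I_scal s _ _ (smooth_I_deriv u n hu))
                                (deriv_I_scal t _ _ (smooth_I_deriv v n hv)) x hx).
Qed.

Lemma Omega_linear_l (s t : R) (u v z : R -> R) :
  smooth_I a b u -> smooth_I a b v -> smooth_I a b z ->
  Omega a b (fun x => s * u x + t * v x) z = s * Omega a b u z + t * Omega a b v z.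
Proof.
  intros hu hv hz. unfold Omega.
  assert (cu := Omega_cont u z hu hz). assert (cv := Omega_cont v z hv hz).
  rewrite <- !RInt_scal_I by assumption.
  assert (cc : forall c f, cont_I f -> cont_I (fun x => c * f x)).
  { intros c f hf. apply cont_I_mult; [intros y; apply continuous_const | exact hf]. }
  rewrite <- RInt_plus_I by (apply cc; assumption).
  apply RInt_ext_I. intros x hx.
  rewrite (Derive_I_n_linear s t u v 2 x hu hv hx).
  assert (e := Derive_I_n_linear s t u v 1 x hu hv hx). simpl Derive_I_n in e at 1.
  rewrite e. simpl. ring.
Qed.

Lemma bracket_deriv (u v : R -> R) : smooth_I a b u -> smooth_I a b v ->
  deriv_I (bracket a b u v)
    (fun x => u x * Derive_I_n a b v 2 x - Derive_I_n a b u 2 x * v x).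
Proof.
  intros hu hv.
  assert (u0 := smooth_I_deriv u 0 hu). assert (v0 := smooth_I_deriv v 0 hv).
  assert (u1 := smooth_I_deriv u 1 hu). assert (v1 := smooth_I_deriv v 1 hv).
  eapply deriv_I_ext; [intros; reflexivity | |
    exact (deriv_I_minus _ _ _ _ (deriv_I_mult _ _ _ _ u0 v1) (deriv_I_mult _ _ _ _ u1 v0))].
  intros x _. simpl. ring.
Qed.

Lemma bracket_deriv2 (u v : R -> R) (x : R) : smooth_I a b u -> smooth_I a b v ->
  in_I a b x ->
  Derive_I_n a b (bracket a b u v) 2 x
  = Derive_I a b u x * Derive_I_n a b v 2 x + u x * Derive_I_n a b v 3 x
    - (Derive_I_n a b u 3 x * v x + Derive_I_n a b u 2 x * Derive_I a b v x).
Proof.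
  intros hu hv hx.
  assert (u0 := smooth_I_deriv u 0 hu). assert (v0 := smooth_I_deriv v 0 hv).
  assert (u2 := smooth_I_deriv u 2 hu). assert (v2 := smooth_I_deriv v 2 hv).
  refine (deriv_I_Derive _ _ (deriv_I_ext _ _ _ _ _ (fun _ _ => eq_refl)
    (deriv_I_minus _ _ _ _ (deriv_I_mult _ _ _ _ u0 v2) (deriv_I_mult _ _ _ _ u2 v0))) x hx).
  intros y hy. symmetry. exact (deriv_I_Derive _ _ (bracket_deriv u v hu hv) y hy).
Qed.

(** The integrand of the cyclic sum is the derivative of minus the cyclic sum of
    [u (v_xx z_x - z_xx v_x)], which vanishes at both endpoints. *)
Lemma Omega_jacobi (u v z : R -> R) : Vect0 a b u -> Vect0 a b v -> Vect0 a b z ->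
  Omega a b (bracket a b u v) z + Omega a b (bracket a b v z) u
  + Omega a b (bracket a b z u) v = 0.
Proof.
  intros (hu & ua & ub) (hv & va & vb) (hz & za & zb). unfold Omega.
  set (I3 := fun u v z x =>
    (u x * Derive_I_n a b v 2 x - Derive_I_n a b u 2 x * v x) * Derive_I_n a b z 2 x
    - (Derive_I_n a b u 1 x * Derive_I_n a b v 2 x + u x * Derive_I_n a b v 3 x
       - (Derive_I_n a b u 3 x * v x + Derive_I_n a b u 2 x * Derive_I_n a b v 1 x))
      * Derive_I_n a b z 1 x).
  assert (hI : forall u v z, smooth_I a b u -> smooth_I a b v -> smooth_I a b z ->
    RInt (fun x => Derive_I a b (bracket a b u v) x * Derive_I_n a b z 2 x -
             Derive_I_n a b (bracket a b u v) 2 x * Derive_I a b z x) a b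
    = RInt (I3 u v z) a b /\ cont_I (I3 u v z)).
  { clear -hab. intros u v z hu hv hz. split.
    - apply RInt_ext_I. intros x hx.
      rewrite bracket_deriv2 by assumption.
      rewrite (deriv_I_Derive _ _ (bracket_deriv u v hu hv) x hx). reflexivity.
    - assert (C : forall w n, smooth_I a b w -> cont_I (Derive_I_n a b w n))
        by (intros; apply smooth_I_cont; assumption).
      assert (cu := C u 0%nat hu). assert (cv := C v 0%nat hv).
      simpl Derive_I_n in cu, cv.
      unfold I3.
      repeat lazymatch goal with
      | |- cont_I (fun x => @?f x - @?g x) => apply (cont_I_minus f g)
      | |- cont_I (fun x => @?f x + @?g x) => apply (cont_I_plus f g)
      | |- cont_I (fun x => @?f x * @?g x) => apply (cont_I_mult f g)
      | |- cont_I (fun x => Derive_I_n a b ?w ?n x) => apply (C w n); assumption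
      | |- _ => assumption
      end. }
  destruct (hI u v z hu hv hz) as [-> c1].
  destruct (hI v z u hv hz hu) as [-> c2].
  destruct (hI z u v hz hu hv) as [-> c3].
  rewrite <- !RInt_plus_I 
    by (first [assumption | apply cont_I_plus; assumption]).
  set (P := fun u v z x => u x * (Derive_I_n a b v 2 x * Derive_I_n a b z 1 x
                                  - Derive_I_n a b z 2 x * Derive_I_n a b v 1 x)).
  set (P' := fun u v z x =>
    Derive_I_n a b u 1 x * (Derive_I_n a b v 2 x * Derive_I_n a b z 1 x
                            - Derive_I_n a b z 2 x * Derive_I_n a b v 1 x)
    + u x * ((Derive_I_n a b v 3 x * Derive_I_n a b z 1 x
              + Derive_I_n a b v 2 x * Derive_I_n a b z 2 x)
             - (Derive_I_n a b z 3 x * Derive_I_n a b v 1 x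
                + Derive_I_n a b z 2 x * Derive_I_n a b v 2 x))).
  assert (hP : forall u v z, smooth_I a b u -> smooth_I a b v -> smooth_I a b z ->
    deriv_I (P u v z) (P' u v z)).
  { clear -hab. intros u v z hu hv hz.
    apply deriv_I_mult; [exact (smooth_I_deriv u 0 hu)|].
    apply deriv_I_minus; apply deriv_I_mult; apply smooth_I_deriv; assumption. }
  rewrite (RInt_deriv_I (fun x => -1 * (P u v z x + P v z u x + P z u v x))).
  - unfold P. rewrite ua, ub, va, vb, za, zb. ring.
  - eapply deriv_I_ext; [intros; reflexivity | |
      exact (deriv_I_scal (-1) _ _ (deriv_I_plus _ _ _ _ (deriv_I_plus _ _ _ _
        (hP u v z hu hv hz) (hP v z u hv hz hu)) (hP z u v hz hu hv)))].
    intros x _. unfold P', I3. ring.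
  - exact (cont_I_plus _ _ (cont_I_plus _ _ c1 c2) c3).
Qed.

Lemma Omega_lie_cocycle : lie_cocycle a b (Omega a b).
Proof.
  split; [split | split].
  - intros s t u v z (hu & _) (hv & _) (hz & _). apply Omega_linear_l; assumption.
  - intros s t u v z (hu & _) (hv & _) (hz & _).
    rewrite !(Omega_skew z) 
      by (first [assumption | apply smooth_I_linear; assumption]).
    rewrite Omega_linear_l by assumption. ring.
  - intros u v (hu & _) (hv & _). apply Omega_skew; assumption.
  - exact Omega_jacobi.
Qed.

(** * Polynomial families of diffeomorphisms *)

(** Polynomials in a space variable [PX] with coefficients polynomial in two
    parameters [PT] and [PS].  Being syntactic, they come with a formal
    derivative, a substitution and a divided difference. *)
Inductive pexp : Type :=
  | PX | PT | PS
  | PC (c : R)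
  | PAdd (p q : pexp)
  | PMul (p q : pexp).

(** The function of [x] defined by [p] at the parameters [t] and [s]. *)
Fixpoint ev (t s : R) (p : pexp) (x : R) : R :=
  match p with
  | PX => x
  | PT => t
  | PS => s
  | PC c => c
  | PAdd p q => ev t s p x + ev t s q x
  | PMul p q => ev t s p x * ev t s q x
  end.

(** Formal derivative in the space variable. *)
Fixpoint pderiv (p : pexp) : pexp :=
  match p with
  | PX => PC 1
  | PT | PS | PC _ => PC 0
  | PAdd p q => PAdd (pderiv p) (pderiv q)
  | PMul p q => PAdd (PMul (pderiv p) q) (PMul p (pderiv q))
  end.

(** [psubst q p] substitutes [q] for the space variable of [p]. *)
Fixpoint psubst (q p : pexp) : pexp :=
  match p with
  | PX => q
  | PT => PT
  | PS => PS
  | PC c => PC c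
  | PAdd p1 p2 => PAdd (psubst q p1) (psubst q p2)
  | PMul p1 p2 => PMul (psubst q p1) (psubst q p2)
  end.

(** Divided difference of [p] with increment [h]: [(p(x+h) - p(x)) / h]. *)
Fixpoint pdiff (h p : pexp) : pexp :=
  match p with
  | PX => PC 1
  | PT | PS | PC _ => PC 0
  | PAdd p q => PAdd (pdiff h p) (pdiff h q)
  | PMul p q => PAdd (PMul (pdiff h p) (psubst (PAdd PX h) q)) (PMul p (pdiff h q))
  end.

Lemma ev_psubst (t s : R) (q p : pexp) (x : R) :
  ev t s (psubst q p) x = ev t s p (ev t s q x).
Proof. induction p; simpl; congruence. Qed.

Lemma ev_pdiff (t s : R) (h p : pexp) (x : R) :
  ev t s p (x + ev t s h x) = ev t s p x + ev t s h x * ev t s (pdiff h p) x.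
Proof.
  induction p; simpl; try ring.
  - rewrite IHp1, IHp2; ring.
  - rewrite ev_psubst; simpl. rewrite IHp1, IHp2; ring.
Qed.

Lemma ev_pdiff_0 (t s : R) (h p : pexp) (x : R) : ev t s h x = 0 ->
  ev t s (pdiff h p) x = ev t s (pderiv p) x.
Proof.
  intros e. induction p; simpl; try congruence.
  rewrite ev_psubst; simpl. rewrite e, Rplus_0_r. congruence.
Qed.

Lemma ev_derive (t s : R) (p : pexp) (x : R) :
  is_derive (ev t s p) x (ev t s (pderiv p) x).
Proof.
  induction p; simpl.
  - apply @is_derive_id.
  - apply @is_derive_const.
  - apply @is_derive_const.
  - apply @is_derive_const.
  - apply @is_derive_plus; assumption.
  - apply (is_derive_mult (ev t s p1) (ev t s p2)); try assumption.
    exact Rmult_comm.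
Qed.

Lemma ev_deriv_I (t s : R) (p : pexp) : deriv_I (ev t s p) (ev t s (pderiv p)).
Proof. apply deriv_I_of_derive. intros; apply ev_derive. Qed.

Lemma ev_smooth (t s : R) (p : pexp) : smooth_I a b (ev t s p).
Proof.
  apply smooth_I_family with (fun f => exists q, f = ev t s q); [|exists p; reflexivity].
  intros f [q ->]. exists (ev t s (pderiv q)). split; [eexists; reflexivity|].
  apply ev_deriv_I.
Qed.

Lemma Derive_I_n_ev (t s : R) (p : pexp) (n : nat) (x : R) : in_I a b x ->
  Derive_I_n a b (ev t s p) n x = ev t s (Nat.iter n pderiv p) x.
Proof.
  revert x. induction n as [|n IH]; intros x hx; [reflexivity|]. simpl.
  apply (deriv_I_Derive _ (ev t s (pderiv (Nat.iter n pderiv p)))); [|exact hx].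
  eapply deriv_I_ext; [intros y hy; symmetry; apply IH, hy | intros; reflexivity |].
  apply ev_deriv_I.
Qed.

Lemma ev_bounded (p : pexp) : exists M, 0 <= M /\ forall t s x,
  Rabs t <= 1 -> Rabs s <= 1 -> in_I a b x -> Rabs (ev t s p x) <= M.
Proof.
  induction p as [| | | c | p (M & hM & HM) q (N & hN & HN) | p (M & hM & HM) q (N & hN & HN)];
    simpl.
  - exists (Rabs a + Rabs b). split.
    { generalize (Rabs_pos a) (Rabs_pos b); lra. }
    intros t s x _ _ [h1 h2].
    revert h1 h2; unfold Rabs; repeat destruct Rcase_abs; lra.
  - exists 1; split; [lra | auto].
  - exists 1; split; [lra | auto].
  - exists (Rabs c); split; [apply Rabs_pos | intros; lra].
  - exists (M + N); split; [lra|]. intros t s x ht hs hx.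
    specialize (HM t s x ht hs hx). specialize (HN t s x ht hs hx).
    eapply Rle_trans; [apply Rabs_triang | lra].
  - exists (M * N); split; [nra|]. intros t s x ht hs hx.
    rewrite Rabs_mult.
    apply Rmult_le_compat; try apply Rabs_pos; auto.
Qed.

Lemma ev_lipschitz (p : pexp) : exists C, 0 <= C /\ forall t s x,
  Rabs t <= 1 -> Rabs s <= 1 -> in_I a b x ->
  Rabs (ev t s p x - ev 0 0 p x) <= C * (Rabs t + Rabs s).
Proof.
  induction p as [| | | c | p (M & hM & HM) q (N & hN & HN) | p (M & hM & HM) q (N & hN & HN)];
    simpl.
  - exists 0; split; [lra|]. intros t s x _ _ _. rewrite Rminus_diag, Rabs_R0; lra.
  - exists 1; split; [lra|]. intros t s x _ _ _. rewrite Rminus_0_r.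
    generalize (Rabs_pos s); lra.
  - exists 1; split; [lra|]. intros t s x _ _ _. rewrite Rminus_0_r.
    generalize (Rabs_pos t); lra.
  - exists 0; split; [lra|]. intros t s x _ _ _. rewrite Rminus_diag, Rabs_R0; lra.
  - exists (M + N); split; [lra|]. intros t s x ht hs hx.
    specialize (HM t s x ht hs hx). specialize (HN t s x ht hs hx).
    replace (_ - _) with ((ev t s p x - ev 0 0 p x) + (ev t s q x - ev 0 0 q x)) by ring.
    eapply Rle_trans; [apply Rabs_triang | lra].
  - destruct (ev_bounded p) as (P & hP & HP). destruct (ev_bounded q) as (Q & hQ & HQ).
    exists (M * Q + P * N); split; [nra|]. intros t s x ht hs hx.
    specialize (HM t s x ht hs hx). specialize (HN t s x ht hs hx).
    specialize (HQ t s x ht hs hx).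
    assert (h0 : Rabs 0 <= 1) by (rewrite Rabs_R0; lra).
    specialize (HP 0 0 x h0 h0 hx).
    replace (_ - _) with ((ev t s p x - ev 0 0 p x) * ev t s q x
                          + ev 0 0 p x * (ev t s q x - ev 0 0 q x)) by ring.
    eapply Rle_trans; [apply Rabs_triang|]. rewrite !Rabs_mult.
    set (A := Rabs t + Rabs s) in *.
    assert (Rabs (ev t s p x - ev 0 0 p x) * Rabs (ev t s q x) <= M * A * Q)
      by (apply Rmult_le_compat; try apply Rabs_pos; assumption).
    assert (Rabs (ev 0 0 p x) * Rabs (ev t s q x - ev 0 0 q x) <= P * (N * A))
      by (apply Rmult_le_compat; try apply Rabs_pos; assumption).
    nra.
Qed.

Lemma ev_continuous_0 (p : pexp) (d : R) : 0 < d -> exists r, 0 < r /\ forall t s x,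
  Rabs t < r -> Rabs s < r -> in_I a b x -> Rabs (ev t s p x - ev 0 0 p x) < d.
Proof.
  intros hd. destruct (ev_lipschitz p) as (C & hC & HC).
  exists (Rmin 1 (d / (2 * (C + 1)))). split.
  { apply Rmin_pos; [lra | apply Rdiv_lt_0_compat; lra]. }
  intros t s x ht hs hx.
  assert (h1 := Rmin_l 1 (d / (2 * (C + 1)))).
  assert (h2 := Rmin_r 1 (d / (2 * (C + 1)))).
  specialize (HC t s x ltac:(lra) ltac:(lra) hx).
  assert (h3 : Rabs t + Rabs s < d / (C + 1)).
  { replace (d / (C + 1)) with (d / (2 * (C + 1)) + d / (2 * (C + 1))) by (field; lra).
    lra. }
  assert (h4 : (C + 1) * (Rabs t + Rabs s) < d).
  { replace d with ((C + 1) * (d / (C + 1))) by (field; lra).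
    apply Rmult_lt_compat_l; lra. }
  generalize (Rabs_pos t) (Rabs_pos s); lra.
Qed.

(** At [(0, 0)], a polynomial family is continuous for the topology of
    [C^oo(I)]. *)
Lemma ev_Cinf_close (p : pexp) (m : nat) (d : R) : 0 < d -> exists r, 0 < r /\
  forall t s, Rabs t < r -> Rabs s < r -> Cinf_close a b m d (ev 0 0 p) (ev t s p).
Proof.
  intros hd. induction m as [|m (r & hr & Hr)].
  - destruct (ev_continuous_0 p d hd) as (r & hr & Hr). exists r; split; [exact hr|].
    intros t s ht hs j x hj hx. replace j with 0%nat by lia. apply Hr; assumption.
  - destruct (ev_continuous_0 (Nat.iter (S m) pderiv p) d hd) as (r' & hr' & Hr').
    exists (Rmin r r'); split; [apply Rmin_pos; assumption|].
    intros t s ht hs j x hj hx.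
    assert (h1 := Rmin_l r r'). assert (h2 := Rmin_r r r').
    destruct (Nat.eq_dec j (S m)) as [-> | ne].
    + rewrite !Derive_I_n_ev by exact hx. apply Hr'; [lra | lra | exact hx].
    + apply Hr; [lra | lra | lia | exact hx].
Qed.

(** The lower bound on the derivative of [f] makes the inverse [g] Lipschitz,
    hence differentiable. *)
Lemma inverse_deriv_I (f f' g : R -> R) (c : R) : 0 < c ->
  maps_I a b g -> (forall y, in_I a b y -> f (g y) = y) ->
  (forall x, in_I a b x -> c <= f' x) -> deriv_I f f' ->
  deriv_I g (fun y => / f' (g y)).
Proof.
  intros hc hm hfg hf' hf y hy.
  assert (hlip : forall y1 y2, in_I a b y1 -> in_I a b y2 ->
    c * Rabs (g y2 - g y1) <= Rabs (y2 - y1)).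
  { assert (H : forall x1 x2, in_I a b x1 -> in_I a b x2 -> x1 < x2 ->
      c * Rabs (x2 - x1) <= Rabs (f x2 - f x1)).
    { intros x1 x2 h1 h2 h12.
      destruct (deriv_I_mean_value f f' x1 x2 hf h1 h2 h12) as (z & hz & ->).
      specialize (hf' z hz). rewrite Rabs_mult, (Rabs_pos_eq (f' z)) by lra.
      apply Rmult_le_compat_r; [apply Rabs_pos | exact hf']. }
    intros y1 y2 h1 h2. rewrite <- (hfg y1 h1) at 2. rewrite <- (hfg y2 h2) at 2.
    destruct (Rtotal_order (g y1) (g y2)) as [h | [h | h]].
    - apply H; auto.
    - rewrite h, !Rminus_diag, Rabs_R0. lra.
    - rewrite !(Rabs_minus_sym _ (g y1)), !(Rabs_minus_sym _ (f (g y1))). apply H; auto. }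
  apply is_derive_I_eps; [exact hy|]. intros eps heps.
  assert (hl := hf' _ (hm y hy)). set (l := f' (g y)) in *.
  destruct (proj1 (is_derive_I_eps f (g y) l (hm y hy)) (hf _ (hm y hy)) (eps * c * c))
    as (d & hd & Hd); [repeat apply Rmult_lt_0_compat; assumption|].
  exists (c * d). split; [apply Rmult_lt_0_compat; assumption|]. intros z hz hzd.
  specialize (hlip y z hy hz).
  assert (h1 : Rabs (g z - g y) < d).
  { apply Rmult_lt_reg_l with c; lra. }
  specialize (Hd _ (hm z hz) h1). rewrite !hfg in Hd by assumption.
  replace (g z - g y - (z - y) * / l) with (- ((z - y - (g z - g y) * l) * / l))
    by (field; lra).
  rewrite Rabs_Ropp, Rabs_mult, (Rabs_pos_eq (/ l))
    by (left; apply Rinv_0_lt_compat; lra).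
  apply Rmult_le_reg_r with l; [lra|].
  rewrite Rmult_assoc, Rinv_l, Rmult_1_r by lra.
  eapply Rle_trans; [exact Hd|].
  assert (0 <= Rabs (z - y)) by apply Rabs_pos.
  apply Rle_trans with (eps * c * Rabs (z - y)).
  - rewrite !Rmult_assoc. do 2 (apply Rmult_le_compat_l; [lra|]). lra.
  - rewrite Rmult_assoc, (Rmult_comm c), <- Rmult_assoc.
    apply Rmult_le_compat_l; [apply Rmult_le_pos; lra | exact hl].
Qed.

(** The inverse [g] of a polynomial diffeomorphism [q] is smooth: the functions
    [p(g) / (q_x(g))^n] with [p] polynomial form a family closed under
    differentiation. *)
Lemma ev_inverse_smooth (t s : R) (q : pexp) (g : R -> R) : maps_I a b g ->
  (forall x, in_I a b x -> 0 < ev t s (pderiv q) x) ->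
  deriv_I g (fun y => / ev t s (pderiv q) (g y)) -> smooth_I a b g.
Proof.
  intros hm hq hg. set (Q := ev t s (pderiv q)) in *.
  set (h := fun p n x => ev t s p x * / Q x ^ n).
  assert (hS : smooth_I a b (fun y => h PX 0%nat (g y))).
  { apply smooth_I_family with (fun f => exists p n, f = fun y => h p n (g y));
      [|exists PX, 0%nat; reflexivity].
    intros f (p & n & ->).
    set (p' := PAdd (PMul (pderiv p) (pderiv q))
                    (PMul (PC (- INR n)) (PMul p (pderiv (pderiv q))))).
    exists (fun y => h p' (S (S n)) (g y)). split; [eexists _, _; reflexivity|].
    eapply deriv_I_ext; [intros; reflexivity | |
      apply (deriv_I_comp_R g _ (h p n) (fun x => Q x * h p' (S (S n)) x) hg)].
    - intros y hy. simpl. field. apply Rgt_not_eq, hq, hm, hy.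
    - intros y hy. assert (hpos := hq _ (hm y hy)).
      assert (d1 := ev_derive t s p (g y)).
      assert (d2 := ev_derive t s (pderiv q) (g y)). fold Q in d2.
      unfold h. auto_derive.
      + repeat split; [eexists; exact d1 | eexists; exact d2 |].
        apply pow_nonzero. lra.
      + change (Derive (fun x => ev t s p x) (g y)) with (Derive (ev t s p) (g y)).
        change (Derive (fun x => Q x) (g y)) with (Derive Q (g y)).
        rewrite (is_derive_unique _ _ _ d1), (is_derive_unique _ _ _ d2).
        unfold p'. simpl ev. fold Q.
        assert (Q (g y) ^ n <> 0) by (apply pow_nonzero; lra).
        destruct n as [|n]; [simpl; field; lra|].
        assert (Q (g y) ^ n <> 0) by (apply pow_nonzero; lra).
        rewrite S_INR. simpl pow. simpl pred. field. split; [assumption|lra]. }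
  intros n x hx. specialize (hS n x hx).
  replace g with (fun y => h PX 0%nat (g y)); [exact hS|].
  apply functional_extensionality. intros y. unfold h. simpl. field.
Qed.

(** A polynomial that fixes the endpoints and has positive derivative on the
    segment is a diffeomorphism. *)
Lemma ev_Diff (t s : R) (q : pexp) (c : R) : 0 < c ->
  ev t s q a = a -> ev t s q b = b ->
  (forall x, in_I a b x -> c <= ev t s (pderiv q) x) -> Diff a b (ev t s q).
Proof.
  intros hc ha hb hq. set (f := ev t s q) in *.
  assert (hcont : continuity f).
  { intros x. apply continuity_pt_filterlim, @ex_derive_continuous.
    eexists; apply ev_derive. }
  assert (hf : deriv_I f (ev t s (pderiv q))) by apply ev_deriv_I.
  assert (hinc : forall x y, in_I a b x -> in_I a b y -> x < y -> f x < f y).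
  { intros x y hx hy hxy.
    destruct (deriv_I_mean_value f _ x y hf hx hy hxy) as (z & hz & e).
    specialize (hq z hz).
    assert (0 < ev t s (pderiv q) z * (y - x)) by (apply Rmult_lt_0_compat; lra). lra. }
  assert (hrange : forall y, Rmin (f a) (f b) <= clamp y <= Rmax (f a) (f b)).
  { intros y. rewrite ha, hb, Rmin_left, Rmax_right by lra. apply clamp_in. }
  (* The inverse, from the intermediate value theorem; [clamp] only makes it
     total. *)
  set (g := fun y => proj1_sig (IVT_gen f a b (clamp y) hcont (hrange y))).
  assert (hg : forall y, in_I a b (g y) /\ f (g y) = clamp y).
  { intros y. unfold g. destruct (IVT_gen f a b (clamp y) hcont (hrange y)) as (x & hx & e).
    simpl. rewrite Rmin_left, Rmax_right in hx by lra. split; assumption. }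
  assert (hm : maps_I a b f).
  { intros x [h1 h2]. split.
    - rewrite <- ha. destruct h1 as [h1 | <-]; [left; apply hinc; unfold in_I; lra | lra].
    - rewrite <- hb. destruct h2 as [h2 | ->]; [left; apply hinc; unfold in_I; lra | lra]. }
  assert (hgm : maps_I a b g) by (intros y _; apply hg).
  assert (hfg : forall y, in_I a b y -> f (g y) = y).
  { intros y hy. rewrite (proj2 (hg y)). apply clamp_id, hy. }
  split; [apply ev_smooth | split; [exact hm | split]].
  - exists g. split; [| split; [exact hgm | split; [| exact hfg]]].
    + apply (ev_inverse_smooth t s q); [exact hgm | |].
      * intros x hx. specialize (hq x hx). lra.
      * apply (inverse_deriv_I f _ g c); assumption.
    + intros x hx. assert (e := hfg _ (hm x hx)). assert (hx' := hgm _ (hm x hx)).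
      destruct (Rtotal_order (g (f x)) x) as [h | [h | h]]; [|exact h|];
        apply hinc in h; try assumption; lra.
  - intros x hx. rewrite (deriv_I_Derive _ _ hf x hx). specialize (hq x hx). lra.
Qed.

(** A polynomial family that fixes the endpoints and starts at the identity
    consists of diffeomorphisms for small parameters. *)
Lemma ev_Diff_near_id (q : pexp) : (forall x, ev 0 0 q x = x) ->
  (forall t s, ev t s q a = a /\ ev t s q b = b) ->
  exists r, 0 < r /\ forall t s, Rabs t < r -> Rabs s < r -> Diff a b (ev t s q).
Proof.
  intros h0 hab'. destruct (ev_continuous_0 (pderiv q) (1 / 2)) as (r & hr & Hr); [lra|].
  exists r; split; [exact hr|]. intros t s ht hs.
  apply ev_Diff with (1 / 2); try apply hab'; [lra|].
  intros x hx. specialize (Hr t s x ht hs hx).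
  assert (e : ev 0 0 (pderiv q) x = 1).
  { rewrite <- (is_derive_unique _ _ _ (ev_derive 0 0 q x)).
    rewrite (Derive_ext _ _ _ h0). apply Derive_id. }
  rewrite e in Hr. apply Rabs_def2 in Hr. lra.
Qed.

(** * Second order expansion of the group cocycle at the identity *)

Lemma cont_I_bounded (f : R -> R) : cont_I f ->
  exists M, 0 <= M /\ forall x, in_I a b x -> Rabs (f x) <= M.
Proof.
  intros hf.
  destruct (continuity_ab_maj (fun x => Rabs (f (clamp x))) a b) as (z & hz & _); [lra | |].
  - intros x _. apply continuity_pt_filterlim.
    apply (continuous_comp (fun y => f (clamp y)) Rabs); [apply hf | apply continuous_Rabs].
  - exists (Rabs (f (clamp z))). split; [apply Rabs_pos|].
    intros x hx. specialize (hz x hx). simpl in hz. rewrite (clamp_id x hx) in hz. exact hz.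
Qed.

Lemma ln_1p_bound (y : R) : Rabs y <= 1 / 2 -> Rabs (ln (1 + y) - y) <= 2 * y ^ 2.
Proof.
  intros hy. apply Rabs_le_between in hy.
  (* Both bounds come from [1 + z <= exp z], at [z = ln (1+y)] and its opposite. *)
  assert (h1 := exp_ineq1_le (ln (1 + y))). rewrite exp_ln in h1 by lra.
  assert (h2 := exp_ineq1_le (- ln (1 + y))). rewrite exp_Ropp, exp_ln in h2 by lra.
  assert (h3 : / (1 + y) = 1 - y + y ^ 2 / (1 + y)) by (field; lra).
  assert (h4 : y ^ 2 / (1 + y) <= 2 * y ^ 2).
  { apply Rmult_le_reg_r with (1 + y); [lra|].
    replace (y ^ 2 / (1 + y) * (1 + y)) with (y ^ 2) by (field; lra).
    assert (0 <= y ^ 2) by apply pow2_ge_0. nra. }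
  apply Rabs_le. lra.
Qed.

(** The curve [t |-> id + t u] through the identity. *)
Definition id_plus (u : R -> R) (t x : R) : R := x + t * u x.

Lemma id_plus_deriv (u : R -> R) (t : R) : smooth_I a b u ->
  deriv_I (id_plus u t) (fun x => 1 + t * Derive_I a b u x).
Proof.
  intros hu. apply (deriv_I_plus (fun x => x) (fun _ => 1)).
  - apply deriv_I_of_derive. intros x _. apply @is_derive_id.
  - apply deriv_I_scal. exact (smooth_I_deriv u 0 hu).
Qed.

Lemma id_plus_deriv2 (u : R -> R) (t x : R) : smooth_I a b u -> in_I a b x ->
  Derive_I_n a b (id_plus u t) 2 x = t * Derive_I_n a b u 2 x.
Proof.
  intros hu hx.
  refine (deriv_I_Derive _ (fun x => t * Derive_I_n a b u 2 x) _ x hx).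
  apply deriv_I_ext with (fun x => 1 + t * Derive_I a b u x)
    (fun x => 0 + t * Derive_I_n a b u 2 x).
  - intros y hy. symmetry. exact (deriv_I_Derive _ _ (id_plus_deriv u t hu) y hy).
  - intros; ring.
  - apply deriv_I_plus; [|apply deriv_I_scal; exact (smooth_I_deriv u 1 hu)].
    apply deriv_I_of_derive. intros y _. apply @is_derive_const.
Qed.

(** [chi (id + t u) (id + t v)] equals [t^2 int u_x v_xx dx] up to [O(t^3)]. *)
Lemma chi_expansion (u v : R -> R) : smooth_I a b u -> smooth_I a b v ->
  exists C r, 0 <= C /\ 0 < r /\ forall t, 0 < t < r ->
    Diff a b (id_plus u t) -> Diff a b (id_plus v t) ->
    Rabs (chi a b (id_plus u t) (id_plus v t)
          - t ^ 2 * RInt (fun x => Derive_I a b u x * Derive_I_n a b v 2 x) a b)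
    <= C * t ^ 3.
Proof.
  intros hu hv.
  assert (hb : exists M, 1 <= M /\ forall x, in_I a b x ->
    Rabs (v x) <= M /\ Rabs (Derive_I a b v x) <= M /\ Rabs (Derive_I_n a b v 2 x) <= M
    /\ Rabs (Derive_I a b u x) <= M /\ Rabs (Derive_I_n a b u 2 x) <= M).
  { destruct (cont_I_bounded _ (smooth_I_cont v 0 hv)) as (M1 & p1 & h1).
    destruct (cont_I_bounded _ (smooth_I_cont v 1 hv)) as (M2 & p2 & h2).
    destruct (cont_I_bounded _ (smooth_I_cont v 2 hv)) as (M3 & p3 & h3).
    destruct (cont_I_bounded _ (smooth_I_cont u 1 hu)) as (M4 & p4 & h4).
    destruct (cont_I_bounded _ (smooth_I_cont u 2 hu)) as (M5 & p5 & h5).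
    exists (1 + M1 + M2 + M3 + M4 + M5); split; [lra|]. intros x hx.
    specialize (h1 x hx); specialize (h2 x hx); specialize (h3 x hx);
    specialize (h4 x hx); specialize (h5 x hx). simpl in *. repeat split; lra. }
  destruct hb as (M & hM & HM).
  exists ((b - a) * (10 * M ^ 3)), (/ (2 * M)).
  assert (hM3 : 0 <= M ^ 3) by (apply pow_le; lra).
  split; [apply Rmult_le_pos; lra|]. split; [apply Rinv_0_lt_compat; lra|].
  intros t [ht0 htr] dphi dpsi.
  assert (htM : t * M <= 1 / 2).
  { replace (1 / 2) with (/ (2 * M) * M) by (field; lra).
    apply Rmult_le_compat_r; lra. }
  set (phi := id_plus u t) in *. set (psi := id_plus v t) in *.
  assert (mpsi : maps_I a b psi) by apply dpsi.
  assert (c0 : cont_I (fun x => Derive_I a b u x * Derive_I_n a b v 2 x)).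
  { apply cont_I_mult; [exact (smooth_I_cont u 1 hu) | exact (smooth_I_cont v 2 hv)]. }
  assert (c1 : cont_I (fun x => logD phi (psi x) * Derive_I a b (logD psi) x)).
  { apply cont_I_mult; [|apply Derive_logD_cont, dpsi].
    apply cont_I_comp; [exact mpsi | exact (deriv_I_cont _ _ (Diff_deriv psi dpsi)) |
                        apply logD_cont, dphi]. }
  assert (c2 : cont_I (fun x => t ^ 2 * (Derive_I a b u x * Derive_I_n a b v 2 x))).
  { apply (cont_I_mult (fun _ => t ^ 2)); [intros x; apply continuous_const | exact c0]. }
  rewrite chi_logD, <- RInt_scal_I by exact c0.
  rewrite <- RInt_minus_I by assumption.
  replace ((b - a) * (10 * M ^ 3) * t ^ 3)
    with ((b - a) * (10 * M ^ 3 * t ^ 3)) by ring.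
  apply abs_RInt_le_const; [lra | |].
  { exact (cont_I_ex_RInt _ (cont_I_minus _ _ c1 c2)). }
  intros x hx.
  destruct (HM x hx) as (b0 & b1 & b2 & b3 & _).
  assert (hpx := mpsi x hx). destruct (HM _ hpx) as (_ & _ & _ & b4 & _).
  (* [u_x] is Lipschitz, hence is almost constant along [psi]. *)
  assert (b5 : Rabs (Derive_I a b u (psi x) - Derive_I a b u x) <= M * (t * M)).
  { assert (H : forall y z, in_I a b y -> in_I a b z -> y < z ->
      Rabs (Derive_I a b u z - Derive_I a b u y) <= M * Rabs (z - y)).
    { intros y z hy hz hyz.
      destruct (deriv_I_mean_value _ _ y z (smooth_I_deriv u 1 hu) hy hz hyz)
        as (w & hw & ew). simpl in ew |- *. rewrite ew, Rabs_mult.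
      apply Rmult_le_compat_r; [apply Rabs_pos | apply (HM w hw)]. }
    assert (h1 : Rabs (psi x - x) <= t * M).
    { unfold psi, id_plus. replace (x + t * v x - x) with (t * v x) by ring.
      rewrite Rabs_mult, (Rabs_pos_eq t) by lra. apply Rmult_le_compat_l; lra. }
    apply Rle_trans with (M * Rabs (psi x - x)); [|apply Rmult_le_compat_l; lra].
    destruct (Rtotal_order x (psi x)) as [h | [h | h]].
    - apply H; assumption.
    - rewrite <- h, !Rminus_diag, Rabs_R0. lra.
    - rewrite (Rabs_minus_sym _ x), (Rabs_minus_sym _ (Derive_I a b u x)).
      apply H; assumption. }
  unfold logD at 1. rewrite (deriv_I_Derive phi _ (id_plus_deriv u t hu) _ hpx).
  rewrite (deriv_I_Derive _ _ (logD_deriv_explicit psi dpsi) x hx).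
  rewrite (id_plus_deriv2 v t x hv hx : Derive_I_n a b psi 2 x = _).
  rewrite (deriv_I_Derive psi _ (id_plus_deriv v t hv) _ hx).
  set (p := Derive_I a b u (psi x)) in *. set (q := Derive_I a b u x) in *.
  set (v1 := Derive_I a b v x) in *. set (v2 := Derive_I_n a b v 2 x) in *.
  assert (tp : Rabs (t * p) <= t * M).
  { rewrite Rabs_mult, (Rabs_pos_eq t) by lra. apply Rmult_le_compat_l; lra. }
  assert (tv1 : Rabs (t * v1) <= t * M).
  { rewrite Rabs_mult, (Rabs_pos_eq t) by lra. apply Rmult_le_compat_l; lra. }
  assert (tv2 : Rabs (t * v2) <= t * M).
  { rewrite Rabs_mult, (Rabs_pos_eq t) by lra. apply Rmult_le_compat_l; lra. }
  assert (tq : Rabs (t * q) <= t * M).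
  { rewrite Rabs_mult, (Rabs_pos_eq t) by lra. apply Rmult_le_compat_l; lra. }
  assert (hA : Rabs (ln (1 + t * p) - t * q) <= 3 * (t * M) ^ 2).
  { replace (ln (1 + t * p) - t * q) with ((ln (1 + t * p) - t * p) + t * (p - q)) by ring.
    eapply Rle_trans; [apply Rabs_triang|].
    assert (h1 := ln_1p_bound (t * p) ltac:(lra)).
    assert (h2 : (t * p) ^ 2 <= (t * M) ^ 2).
    { rewrite <- (pow2_abs (t * p)). apply pow_incr. split; [apply Rabs_pos | exact tp]. }
    assert (h3 : Rabs (t * (p - q)) <= (t * M) ^ 2).
    { rewrite Rabs_mult, (Rabs_pos_eq t) by lra.
      replace ((t * M) ^ 2) with (t * (M * (t * M))) by ring.
      apply Rmult_le_compat_l; lra. }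
    lra. }
  assert (hpos : 1 / 2 <= 1 + t * v1).
  { apply Rabs_le_between in tv1. lra. }
  assert (hinv : 0 < / (1 + t * v1) <= 2).
  { split; [apply Rinv_0_lt_compat; lra|].
    replace 2 with (/ (1 / 2)) by field. apply Rinv_le_contravar; lra. }
  assert (hB : Rabs (t * v2 * / (1 + t * v1)) <= 2 * (t * M)).
  { rewrite Rabs_mult, (Rabs_pos_eq (/ _)) by lra.
    rewrite (Rmult_comm 2). apply Rmult_le_compat; try lra; apply Rabs_pos. }
  assert (hB' : Rabs (t * v2 * / (1 + t * v1) - t * v2) <= 2 * (t * M) ^ 2).
  { replace (t * v2 * / (1 + t * v1) - t * v2)
      with (- (t * v2 * / (1 + t * v1) * (t * v1))) by (field; lra).
    rewrite Rabs_Ropp, Rabs_mult.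
    replace (2 * (t * M) ^ 2) with (2 * (t * M) * (t * M)) by ring.
    apply Rmult_le_compat; try apply Rabs_pos; assumption. }
  match goal with |- Rabs ?X <= _ => replace X with
    ((ln (1 + t * p) - t * q) * (t * v2 * / (1 + t * v1))
     + t * q * (t * v2 * / (1 + t * v1) - t * v2)) by (field; lra) end.
  eapply Rle_trans; [apply Rabs_triang|]. rewrite (Rabs_mult (ln _ - _)), (Rabs_mult (t * q)).
  assert (g1 := Rmult_le_compat _ _ _ _ (Rabs_pos _) (Rabs_pos _) hA hB).
  assert (g2 := Rmult_le_compat _ _ _ _ (Rabs_pos _) (Rabs_pos _) tq hB').
  replace (10 * M ^ 3 * t ^ 3) with (10 * (t * M) ^ 3) by ring.
  assert (0 <= (t * M) ^ 3) by (apply pow_le, Rmult_le_pos; lra).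
  nra.
Qed.

(** [Omega] is twice the skew part of the second order term of [chi]. *)
Lemma Omega_split (u v : R -> R) : smooth_I a b u -> smooth_I a b v ->
  Omega a b u v = RInt (fun x => Derive_I a b u x * Derive_I_n a b v 2 x) a b
                  - RInt (fun x => Derive_I a b v x * Derive_I_n a b u 2 x) a b.
Proof.
  intros hu hv.
  assert (C : forall u v, smooth_I a b u -> smooth_I a b v ->
    cont_I (fun x => Derive_I a b u x * Derive_I_n a b v 2 x)).
  { clear -hab. intros u v hu hv.
    apply cont_I_mult; [exact (smooth_I_cont u 1 hu) | exact (smooth_I_cont v 2 hv)]. }
  rewrite <- RInt_minus_I by (apply C; assumption).
  apply RInt_ext_I. intros x _. ring.
Qed.

(** * The cocycle is not a coboundary *)

(** If [chi] is the coboundary of [f], the commutator of [id + t u] and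
    [id + t v] shows that the differential of [f] at the identity, evaluated at
    [v u_x - u v_x], is [- Omega u v].  Here [F nil] is [f] and [F (k :: nil) phi]
    is its derivative at [phi] in the direction [k]. *)
Lemma coboundary_derivative (f : (R -> R) -> R) (F : list (R -> R) -> (R -> R) -> R)
    (u v : pexp) :
  (forall phi, Diff a b phi -> F nil phi = f phi) ->
  (forall k phi, Vect0 a b k -> Diff a b phi ->
     is_derive (fun t => F nil (fun x => phi x + t * k x)) 0 (F (k :: nil) phi)) ->
  (forall k phi, Vect0 a b k -> Diff a b phi -> forall eps, 0 < eps ->
     exists m d, 0 < d /\ forall k' phi', Vect0 a b k' -> Diff a b phi' ->
       Cinf_close a b m d k k' -> Cinf_close a b m d phi phi' ->
       Rabs (F (k' :: nil) phi' - F (k :: nil) phi) < eps) ->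
  (forall phi psi, Diff a b phi -> Diff a b psi ->
     chi a b phi psi = f phi + f psi - f (comp phi psi)) ->
  (forall t s x, ev t s u x = ev 0 0 u x) -> (forall t s x, ev t s v x = ev 0 0 v x) ->
  ev 0 0 u a = 0 -> ev 0 0 u b = 0 -> ev 0 0 v a = 0 -> ev 0 0 v b = 0 ->
  F ((fun x => ev 0 0 v x * ev 0 0 (pderiv u) x - ev 0 0 u x * ev 0 0 (pderiv v) x) :: nil)
    (fun x => x) = - Omega a b (ev 0 0 u) (ev 0 0 v).
Proof.
  intros hF hF1 hFc hchi iu iv ua ub va vb.
  set (U := ev 0 0 u) in *. set (V := ev 0 0 v) in *.
  assert (hU : smooth_I a b U) by apply ev_smooth.
  assert (hV : smooth_I a b V) by apply ev_smooth.
  set (pu := PAdd PX (PMul PT u)). set (pv := PAdd PX (PMul PT v)).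
  set (k := PAdd (PMul v (pdiff (PMul PT v) u))
                 (PMul (PC (-1)) (PMul u (pdiff (PMul PT u) v)))).
  (* Joins [id_plus v t o id_plus u t], at [s = 0], to [id_plus u t o id_plus v t],
     at [s = t ^ 2]. *)
  set (path := PAdd (psubst pu pv) (PMul PS k)).
  set (k0 := fun x => V x * ev 0 0 (pderiv u) x - U x * ev 0 0 (pderiv v) x).
  assert (ek0 : ev 0 0 k = k0).
  { apply functional_extensionality. intros x. unfold k, k0. simpl.
    rewrite !ev_pdiff_0 by (simpl; ring). unfold U, V. ring. }
  assert (epu : forall t s, ev t s pu = id_plus U t).
  { intros t s. apply functional_extensionality. intros x. unfold pu, id_plus. simpl.
    rewrite iu. reflexivity. }
  assert (epv : forall t s, ev t s pv = id_plus V t).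
  { intros t s. apply functional_extensionality. intros x. unfold pv, id_plus. simpl.
    rewrite iv. reflexivity. }
  assert (ek : forall t s x, id_plus U t (id_plus V t x)
                 = id_plus V t (id_plus U t x) + t ^ 2 * ev t s k x).
  { intros t s x. unfold id_plus.
    assert (e1 := ev_pdiff t s (PMul PT v) u x). assert (e2 := ev_pdiff t s (PMul PT u) v x).
    simpl ev in e1, e2. rewrite !iu, !iv in e1, e2. unfold k. simpl.
    rewrite e1, e2, iu, iv. fold U V. ring. }
  assert (epx : forall t s x, ev t s path x
                  = id_plus V t (id_plus U t x) + s * ev t s k x).
  { intros t s x. rewrite <- (epv t s), <- (epu t s), <- ev_psubst. reflexivity. }
  assert (epath : forall t s, t <> 0 -> ev t s path
                    = fun x => id_plus V t (id_plus U t x) + s * ev t 0 k x).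
  { intros t s ht. apply functional_extensionality. intros x. rewrite epx. do 2 f_equal.
    (* By [ek], [t ^ 2 * ev t s k x] does not depend on [s]. *)
    apply Rmult_eq_reg_l with (t ^ 2); [|apply pow_nonzero; exact ht].
    assert (e1 := ek t s x). assert (e2 := ek t 0 x). lra. }
  assert (ka : forall t s, ev t s k a = 0 /\ ev t s k b = 0).
  { intros t s. unfold k. simpl. rewrite !iu, !iv, ua, ub, va, vb. split; ring. }
  assert (vk : forall t s, Vect0 a b (ev t s k)).
  { intros t s. split; [apply ev_smooth | apply ka]. }
  assert (patha : forall t s, ev t s path a = a /\ ev t s path b = b).
  { intros t s. rewrite !epx. destruct (ka t s) as [-> ->].
    unfold id_plus.
    rewrite ua, ub, !Rmult_0_r, !Rplus_0_r, va, vb. split; ring. }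
  assert (path0 : forall x, ev 0 0 path x = x).
  { intros x. rewrite epx. unfold id_plus. ring. }
  assert (epath0 : ev 0 0 path = fun x => x) by (apply functional_extensionality, path0).
  destruct (ev_Diff_near_id path path0 patha) as (r1 & hr1 & D1).
  destruct (ev_Diff_near_id pu) as (r2 & hr2 & D2).
  { intros x. rewrite epu. unfold id_plus. ring. }
  { intros t s. rewrite epu. unfold id_plus. rewrite ua, ub. split; ring. }
  destruct (ev_Diff_near_id pv) as (r3 & hr3 & D3).
  { intros x. rewrite epv. unfold id_plus. ring. }
  { intros t s. rewrite epv. unfold id_plus. rewrite va, vb. split; ring. }
  destruct (chi_expansion U V hU hV) as (C1 & r4 & hC1 & hr4 & E1).
  destruct (chi_expansion V U hV hU) as (C2 & r5 & hC2 & hr5 & E2).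
  assert (did : Diff a b (fun x => x)).
  { rewrite <- epath0. apply D1; rewrite Rabs_R0; lra. }
  assert (vk0 : Vect0 a b k0) by (rewrite <- ek0; apply vk).
  apply Rminus_diag_uniq. apply Rabs_eq_0. apply Rle_antisym; [|apply Rabs_pos].
  apply le_epsilon. intros eps heps. rewrite Rplus_0_l.
  destruct (hFc k0 (fun x => x) vk0 did (eps / 2)) as (m & d & hd & Hd); [lra|].
  destruct (ev_Cinf_close k m d hd) as (r6 & hr6 & K6).
  destruct (ev_Cinf_close path m d hd) as (r7 & hr7 & K7).
  rewrite ek0 in K6. rewrite epath0 in K7.
  (* One [t] small enough for all the estimates. *)
  assert (ht : exists t, 0 < t /\ t < 1 /\ t < r1 /\ t < r2 /\ t < r3 /\ t < r4
                 /\ t < r5 /\ t < r6 /\ t < r7 /\ (C1 + C2) * t <= eps / 2).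
  { set (r := Rmin (eps / 2 / (C1 + C2 + 1)) (Rmin 1 (Rmin r1 (Rmin r2 (Rmin r3
                (Rmin r4 (Rmin r5 (Rmin r6 r7)))))))).
    assert (hr : 0 < r).
    { unfold r. repeat apply Rmin_pos; try assumption; try lra.
      apply Rdiv_lt_0_compat; lra. }
    exists (r / 2).
    assert (h0 : r <= eps / 2 / (C1 + C2 + 1)) by apply Rmin_l.
    assert (hm : r <= 1 /\ r <= r1 /\ r <= r2 /\ r <= r3 /\ r <= r4 /\ r <= r5
                 /\ r <= r6 /\ r <= r7).
    { clear -r. unfold r. repeat split;
        repeat first [apply Rle_refl | apply Rmin_l | (eapply Rle_trans; [apply Rmin_r|])]. }
    repeat (split; [lra|]).
    apply Rle_trans with ((C1 + C2 + 1) * r); [nra|].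
    replace (eps / 2) with ((C1 + C2 + 1) * (eps / 2 / (C1 + C2 + 1))) by (field; lra).
    apply Rmult_le_compat_l; lra. }
  destruct ht as (t & t0 & t1 & tr1 & tr2 & tr3 & tr4 & tr5 & tr6 & tr7 & hCt).
  assert (at_ : Rabs t = t) by (apply Rabs_pos_eq; lra).
  assert (t2 : 0 < t ^ 2 < t) by (simpl; nra).
  assert (as_ : forall s, 0 <= s <= t ^ 2 -> Rabs s < t).
  { intros s hs. rewrite Rabs_pos_eq; lra. }
  assert (a0 : Rabs 0 < t) by (rewrite Rabs_R0; exact t0).
  assert (dU : Diff a b (id_plus U t)) by (rewrite <- (epu t 0); apply D2; lra).
  assert (dV : Diff a b (id_plus V t)) by (rewrite <- (epv t 0); apply D3; lra).
  assert (Dpath : forall s, 0 <= s <= t ^ 2 -> Diff a b (ev t s path)).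
  { intros s hs. specialize (as_ s hs). apply D1; lra. }
  assert (eUV : comp (id_plus U t) (id_plus V t) = ev t (t ^ 2) path).
  { rewrite epath by lra. apply functional_extensionality. intros x. apply ek. }
  assert (eVU : comp (id_plus V t) (id_plus U t) = ev t 0 path).
  { rewrite epath by lra. apply functional_extensionality. intros x. unfold comp. ring. }
  assert (hder : forall s, 0 <= s <= t ^ 2 ->
    is_derive (fun s => F nil (ev t s path)) s (F (ev t 0 k :: nil) (ev t s path))).
  { intros s hs. specialize (hF1 (ev t 0 k) (ev t s path) (vk t 0) (Dpath s hs)).
    apply is_derive_ext with
      (fun s' => (fun h => F nil (fun x => ev t s path x + h * ev t 0 k x)) (s' - s)).
    { intros s'. f_equal. rewrite !epath by lra.
      apply functional_extensionality. intros x. ring. }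
    evar_last.
    - apply (is_derive_comp (fun h => F nil (fun x => ev t s path x + h * ev t 0 k x))
               (fun s' => s' - s) s (F (ev t 0 k :: nil) (ev t s path)) 1).
      + replace (s - s) with 0 by ring. exact hF1.
      + auto_derive; [exact I | ring].
    - unfold scal; simpl; unfold mult; simpl. ring. }
  destruct (MVT_gen (fun s => F nil (ev t s path)) 0 (t ^ 2)
              (fun s => F (ev t 0 k :: nil) (ev t s path))) as (s & hs & es).
  { rewrite Rmin_left, Rmax_right by lra. intros s hs. apply hder; lra. }
  { rewrite Rmin_left, Rmax_right by lra. intros s hs.
    apply continuity_pt_filterlim, @ex_derive_continuous. eexists. apply hder, hs. }
  rewrite Rmin_left, Rmax_right in hs by lra.
  rewrite !hF in es by (apply Dpath; lra).
  rewrite <- eUV, <- eVU in es.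
  assert (c1 := hchi _ _ dU dV). assert (c2 := hchi _ _ dV dU).
  specialize (E1 t (conj t0 tr4) dU dV). specialize (E2 t (conj t0 tr5) dV dU).
  assert (hs' := as_ s hs).
  specialize (Hd (ev t 0 k) (ev t s path) (vk t 0) (Dpath s hs)
    (K6 t 0 ltac:(lra) ltac:(lra)) (K7 t s ltac:(lra) ltac:(lra))).
  rewrite Omega_split by assumption.
  set (J1 := RInt (fun x => Derive_I a b U x * Derive_I_n a b V 2 x) a b) in *.
  set (J2 := RInt (fun x => Derive_I a b V x * Derive_I_n a b U 2 x) a b) in *.
  set (A := F (ev t 0 k :: nil) (ev t s path)) in *.
  assert (hA : Rabs (A - - (J1 - J2)) <= (C1 + C2) * t).
  { apply Rmult_le_reg_l with (t ^ 2); [lra|].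
    rewrite <- (Rabs_pos_eq (t ^ 2)) at 1 by lra. rewrite <- Rabs_mult.
    replace (t ^ 2 * (A - - (J1 - J2))) with
      ((chi a b (id_plus V t) (id_plus U t) - t ^ 2 * J2)
       - (chi a b (id_plus U t) (id_plus V t) - t ^ 2 * J1)) by lra.
    unfold Rminus at 1. eapply Rle_trans; [apply Rabs_triang|]. rewrite Rabs_Ropp.
    replace (t ^ 2 * ((C1 + C2) * t)) with (C2 * t ^ 3 + C1 * t ^ 3) by ring. lra. }
  replace (F (k0 :: nil) (fun x => x) - - (J1 - J2))
    with ((A - - (J1 - J2)) - (A - F (k0 :: nil) (fun x => x))) by ring.
  unfold Rminus at 1. eapply Rle_trans; [apply Rabs_triang|]. rewrite Rabs_Ropp. lra.
Qed.

Lemma Omega_ev (u v : pexp) (G : R -> R) :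
  (forall x, is_derive G x (ev 0 0 (pderiv u) x * ev 0 0 (pderiv (pderiv v)) x
                            - ev 0 0 (pderiv (pderiv u)) x * ev 0 0 (pderiv v) x)) ->
  Omega a b (ev 0 0 u) (ev 0 0 v) = G b - G a.
Proof.
  intros hG. apply RInt_deriv_I; [|apply Omega_cont; apply ev_smooth].
  intros x hx.
  rewrite !Derive_I_n_ev by exact hx. rewrite !(deriv_I_Derive _ _ (ev_deriv_I _ _ _) x hx).
  apply is_derive_is_derive_I; [exact hx | apply hG].
Qed.

(** With [w = (x-a)(b-x)], the pairs [(w, w(x-a)^3/3)] and [(w(x-a), w(x-a)^2)]
    have the same bracket [w^2 (x-a)^2], but [Omega] takes on them the distinct
    values [(b-a)^5/3] and [2(b-a)^5/5]; no linear form composed with the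
    bracket can do this. *)
Lemma chi_not_coboundary : ~ group_coboundary a b (chi a b).
Proof.
  intros (f & (F & hF & hF1 & hFc) & hchi).
  assert (H := fun u v => coboundary_derivative f F u v hF
    (fun k phi => hF1 nil k phi (Forall_nil _))).
  assert (hFc1 : forall k phi, Vect0 a b k -> Diff a b phi -> forall eps, 0 < eps ->
     exists m d, 0 < d /\ forall k' phi', Vect0 a b k' -> Diff a b phi' ->
       Cinf_close a b m d k k' -> Cinf_close a b m d phi phi' ->
       Rabs (F (k' :: nil) phi' - F (k :: nil) phi) < eps).
  { intros k phi hk hphi eps heps.
    destruct (hFc (k :: nil) phi (Forall_cons _ hk (Forall_nil _)) hphi eps heps)
      as (m & d & hd & Hd).
    exists m, d; split; [exact hd|]. intros k' phi' hk' hphi' c1 c2.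
    apply Hd; auto. }
  set (y := PAdd PX (PC (- a))).
  set (w := PMul y (PAdd (PC b) (PMul (PC (-1)) PX))).
  set (v1 := PMul w (PMul (PC (1 / 3)) (PMul y (PMul y y)))).
  set (u2 := PMul w y). set (v2 := PMul w (PMul y y)).
  assert (e1 := H w v1 hFc1 hchi ltac:(reflexivity) ltac:(reflexivity)
    ltac:(simpl; ring) ltac:(simpl; ring) ltac:(simpl; ring) ltac:(simpl; ring)).
  assert (e2 := H u2 v2 hFc1 hchi ltac:(reflexivity) ltac:(reflexivity)
    ltac:(simpl; ring) ltac:(simpl; ring) ltac:(simpl; ring) ltac:(simpl; ring)).
  assert (e : (fun x => ev 0 0 v1 x * ev 0 0 (pderiv w) x - ev 0 0 w x * ev 0 0 (pderiv v1) x)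
            = (fun x => ev 0 0 v2 x * ev 0 0 (pderiv u2) x - ev 0 0 u2 x * ev 0 0 (pderiv v2) x)).
  { apply functional_extensionality. intros x. simpl. field. }
  rewrite e, e2 in e1.
  rewrite (Omega_ev w v1 (fun x => (4 * (b - a) ^ 2 * (x - a) ^ 3
             - 9 * (b - a) * (x - a) ^ 4 + 6 * (x - a) ^ 5) / 3)) in e1.
  2: { intros x. auto_derive; [exact I | simpl; field]. }
  rewrite (Omega_ev u2 v2 (fun x => 2 * (b - a) ^ 2 * (x - a) ^ 3
             - 4 * (b - a) * (x - a) ^ 4 + 12 / 5 * (x - a) ^ 5)) in e1.
  2: { intros x. auto_derive; [exact I | simpl; field]. }
  assert (0 < (b - a) ^ 5) by (apply pow_lt; lra).
  revert e1. rewrite Rminus_diag. simpl pow in *. nra.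
Qed.

End Segment.

Theorem theorem1p3 : forall (a b : R), a < b ->
  (group_cocycle a b (chi a b) /\ ~ group_coboundary a b (chi a b)) /\
  lie_cocycle a b (Omega a b).
Proof.
  intros a b hab. split; [split|].
  - exact (chi_group_cocycle a b hab).
  - exact (chi_not_coboundary a b hab).
  - exact (Omega_lie_cocycle a b hab).
Qed.
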